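(* Let $b\ge2$ be an integer and let $\mathbf{s}=s_1s_2\ldots$ be a Sturmian or quasi-Sturmian word over $\{0,1,\ldots,b-1\}$. Then $$\mu\Big(\sum_{j\ge1}\frac{s_j}{b^j}\Big)\ge\frac53+\frac{4\sqrt{10}}{15}=2.5099\ldots,$$ with equality when $\mathbf{s}$ is the word $s_n=\lfloor (n+1)\theta+\rho\rfloor-\lfloor n\theta+\rho\rfloor$ ($n\ge1$) over $\{0,1\}$ with $\theta=\frac{\sqrt{10}-2}{3}$ and $\rho=\frac{\sqrt{10}-1}{3}$.
   Context: $p(n,\mathbf{s})$ is the number of distinct factors of length $n$ of $\mathbf{s}$. A Sturmian word satisfies $p(n,\mathbf{s})=n+1$ for all $n\ge1$; a quasi-Sturmian word satisfies $p(n,\mathbf{s})=n+k$ for all $n\ge n_0$, for some integers $k,n_0$. The irrationality exponent $\mu(\xi)$ is the supremum of the real $\mu$ such that $|\xi-p/q|<q^{-\mu}$ has infinitely many rational solutions $p/q$. *)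

(* Defs.v *)
From Stdlib Require Import Reals ZArith List.
From Coquelicot Require Import Coquelicot.
Import ListNotations.
Open Scope R_scope.

(* An infinite word s = s_1 s_2 ... is a function nat -> nat; only the
   positions j >= 1 are used (s 0 is ignored), following the paper's indexing. *)
Definition word := nat -> nat.

Definition word_over (b : nat) (s : word) : Prop := forall j, (1 <= j)%nat -> (s j < b)%nat.

Definition factor_at (s : word) (i n : nat) : list nat := map s (seq i n).

Definition is_factor (s : word) (n : nat) (u : list nat) : Prop :=
  exists i, (1 <= i)%nat /\ u = factor_at s i n.

Definition complexity_is (s : word) (n m : nat) : Prop :=
  exists l : list (list nat), NoDup l /\ length l = m /\
    (forall u, In u l <-> is_factor s n u).

Definition sturmian (s : word) : Prop :=
  forall n, (1 <= n)%nat -> complexity_is s n (S n).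

Definition quasi_sturmian (s : word) : Prop :=
  exists (k : Z) (n0 : nat), forall n, (n0 <= n)%nat ->
    exists m, complexity_is s n m /\ Z.of_nat m = (Z.of_nat n + k)%Z.

Definition word_value (b : nat) (s : word) : R :=
  Series (fun j => INR (s (S j)) / INR b ^ (S j)).

Definition approx_sol (xi mu : R) (pq : Z * Z) : Prop :=
  let (p, q) := pq in
  (0 < q)%Z /\ Z.gcd p q = 1%Z /\
  Rabs (xi - IZR p / IZR q) < Rpower (IZR q) (- mu).

Definition infinitely_many_sols (xi mu : R) : Prop :=
  ~ (exists l : list (Z * Z), forall pq, approx_sol xi mu pq -> In pq l).

Definition irr_exponent (xi : R) : Rbar :=
  Lub_Rbar (fun mu => infinitely_many_sols xi mu).

Definition theta0 : R := (sqrt 10 - 2) / 3.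
Definition rho0 : R := (sqrt 10 - 1) / 3.
Definition extremal_word : word :=
  fun n => Z.to_nat (Int_part (INR (S n) * theta0 + rho0) - Int_part (INR n * theta0 + rho0)).

Definition bound_const : R := 5 / 3 + 4 * sqrt 10 / 15.

(* Main.v *)
Require Import Defs.
From Stdlib Require Import Reals ZArith List Lia Lra Psatz Arith Classical.
From Coquelicot Require Import Coquelicot.
Import ListNotations.

(** Let w be the first position at which a factor of length n of the word repeats an earlier one, at
    position u. Then xi is within about b^-(w+n) of a rational with denominator b^w - b^u, so
    it suffices to find infinitely many n with n / w close to the bound minus 1. Uniqueness of the right
    special factor of each length shows that, for maximal n, the next value of w is n plus a constant.
    If n / w stays below 1.51, then the repetitions starting at u = 0 and at u > 0 alternate, and the
    triple (z, u, v), z being the value of w for the former and w = u + v for the latter, evolves by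
    (z, u, v) -> (z + (j+1) v, u + v, z + j v). Only j = 0 and j = 1 can occur, eventually in the pattern
    1, 0, 0, and the direction of the triple then converges to an eigenvector on which n / w attains
    the bound. For the extremal word, the first repetitions are governed by a lattice
    coset in Z[sqrt 10] invariant under the unit 3 + sqrt 10; this yields six geometric families
    of rationals whose denominators leave no gap, hence an upper bound for the exponent. *)

Open Scope nat_scope.

(** * Factors and complexity *)

(** The walk through the Rauzy graphs returns to its initial vertex only if every prefix recurs;
    this is achieved by deleting a prefix, whose fixed length does not affect the limit of n / w.
    The same holds for the offset K of the complexity, which is negligible once n is large. The
    critical value [bound_const - 1] is irrational and reached only in the limit, so the
    combinatorics runs with the rational threshold 151 / 100: every excluded pattern is then a
    linear infeasibility, and the exact constant enters only through the eigenvector. The unit 3 +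
    sqrt 10 is the dominant eigenvalue of the pattern 1, 0, 0, and the extremal word realises the
    limiting cycle exactly: its repetitions reproduce themselves under the unit, so that infinitely
    many checks reduce to six finite ones. *)

Definition fac (t : nat -> nat) (n i : nat) : list nat := map t (seq i n).

Lemma fac_eq t n i j : fac t n i = fac t n j <-> forall k, k < n -> t (i + k) = t (j + k).
Proof.
  unfold fac; revert i j; induction n as [|n IH]; intros i j; simpl.
  - split; [lia | reflexivity].
  - split.
    + intros E k Hk. injection E as E0 E1. destruct k as [|k].
      * now rewrite !Nat.add_0_r.
      * apply IH with (k := k) in E1; [|lia].
        now replace (i + S k) with (S i + k) by lia; replace (j + S k) with (S j + k) by lia.
    + intros E. f_equal.
      * specialize (E 0). rewrite !Nat.add_0_r in E. apply E; lia.
      * apply IH. intros k Hk. specialize (E (S k)).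
        replace (S i + k) with (i + S k) by lia; replace (S j + k) with (j + S k) by lia.
        apply E; lia.
Qed.

Lemma fac_sub t n m a i j : fac t n i = fac t n j -> a + m <= n -> fac t m (i + a) = fac t m (j + a).
Proof.
  rewrite !fac_eq; intros E H k Hk. rewrite <- !Nat.add_assoc. apply E; lia.
Qed.

Lemma fac_succ t n i j : fac t (S n) i = fac t (S n) j -> fac t n (S i) = fac t n (S j).
Proof.
  intros E. replace (S i) with (i + 1) by lia. replace (S j) with (j + 1) by lia.
  eapply fac_sub; [exact E | lia].
Qed.

Lemma fac_le t n m i j : fac t n i = fac t n j -> m <= n -> fac t m i = fac t m j.
Proof.
  intros E H. rewrite <- (Nat.add_0_r i), <- (Nat.add_0_r j). eapply fac_sub; eauto.
Qed.

Lemma fac_S t n i j : fac t (S n) i = fac t (S n) j <-> fac t n i = fac t n j /\ t (i + n) = t (j + n).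
Proof.
  rewrite !fac_eq; split.
  - intros E; split; intros; apply E; lia.
  - intros [E E'] k Hk. destruct (Nat.eq_dec k n) as [->|]; [easy | apply E; lia].
Qed.

Lemma firstn_fac t n i : firstn n (fac t (S n) i) = fac t n i.
Proof.
  unfold fac. rewrite firstn_map. f_equal.
  revert i; induction n as [|n IH]; intros i; [reflexivity|].
  change (seq i (S (S n))) with (i :: seq (S i) (S n)). cbn [firstn]. now rewrite IH.
Qed.

(** * Complexity, periodicity and the Morse-Hedlund theorem *)

Definition complete (t : nat -> nat) (n : nat) (l : list (list nat)) : Prop :=
  NoDup l /\ forall u, In u l <-> exists i, u = fac t n i.

Definition quasi (t : nat -> nat) (K : nat) : Prop :=
  exists n0, forall n, n0 <= n -> exists l, complete t n l /\ length l = n + K.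

Definition eventually_periodic (t : nat -> nat) : Prop :=
  exists a p, 0 < p /\ forall i, a <= i -> t (i + p) = t i.

Lemma NoDup_map_inj {A B} (f : A -> B) l x y :
  NoDup (map f l) -> In x l -> In y l -> f x = f y -> x = y.
Proof.
  induction l as [|a l IH]; simpl; [easy|].
  intros H Hx Hy E. inversion_clear H as [|? ? H1 H2].
  destruct Hx as [->|Hx], Hy as [->|Hy]; auto.
  - destruct H1. rewrite E. now apply in_map.
  - destruct H1. rewrite <- E. now apply in_map.
Qed.

Lemma pigeon t n l w : complete t n l -> length l < w ->
  exists i j, i < j < w /\ fac t n i = fac t n j.
Proof.
  intros [Hnd Hl] Hw. apply NNPP; intros Hno.
  assert (Hd : NoDup (map (fac t n) (seq 0 w))).
  { apply NoDup_map_NoDup_ForallPairs; [|apply seq_NoDup].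
    intros i j Hi Hj E. apply in_seq in Hi, Hj.
    destruct (lt_eq_lt_dec i j) as [[|]|]; [|easy|]; exfalso; apply Hno.
    - exists i, j; split; [lia | easy].
    - exists j, i; split; [lia | easy]. }
  apply NoDup_incl_length with (l' := l) in Hd.
  - rewrite length_map, length_seq in Hd. lia.
  - intros u Hu. apply in_map_iff in Hu as (i & <- & _). apply Hl. now exists i.
Qed.

Lemma min_ex (P : nat -> Prop) : (exists n, P n) -> exists n, P n /\ forall m, m < n -> ~ P m.
Proof.
  intros [n Hn]. induction n as [n IH] using lt_wf_ind.
  destruct (classic (exists m, m < n /\ P m)) as [(m & Hm & Pm)|H].
  - now apply (IH m).
  - exists n; split; [easy|]. intros m Hm Pm. apply H; eauto.
Qed.

Lemma periodic_bounded t a p n l : 0 < p -> (forall i, a <= i -> t (i + p) = t i) ->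
  complete t n l -> length l <= a + p.
Proof.
  intros Hp Ht [Hnd Hl].
  assert (Hinc : incl l (map (fac t n) (seq 0 (a + p)))).
  { intros u Hu. apply Hl in Hu as [i ->].
    assert (Hi : exists j, j < a + p /\ fac t n i = fac t n j).
    { induction i as [i IH] using lt_wf_ind.
      destruct (lt_dec i (a + p)) as [H|H]; [now exists i|].
      destruct (IH (i - p)) as (j & Hj & E); [lia|]. exists j; split; [easy|].
      rewrite <- E. apply fac_eq. intros k Hk.
      replace (i + k) with (i - p + k + p) by lia. apply Ht; lia. }
    destruct Hi as (j & Hj & ->). apply in_map, in_seq; lia. }
  apply NoDup_incl_length in Hinc; [|easy]. now rewrite length_map, length_seq in Hinc.
Qed.

Lemma quasi_aperiodic t K : quasi t K -> ~ eventually_periodic t.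
Proof.
  intros [n0 H] (a & p & Hp & Ht).
  destruct (H (n0 + a + p + 1)) as (l & Hc & Hlen); [lia|].
  pose proof (periodic_bounded _ _ _ _ _ Hp Ht Hc). lia.
Qed.

Lemma complete_trunc t n l : complete t (S n) l ->
  complete t n (nodup (list_eq_dec Nat.eq_dec) (map (firstn n) l)).
Proof.
  intros [Hnd Hl]; split; [apply NoDup_nodup|].
  intros u; rewrite nodup_In, in_map_iff; split.
  - intros (x & <- & Hx). apply Hl in Hx as [i ->]. exists i. apply firstn_fac.
  - intros [i ->]. exists (fac t (S n) i). split; [apply firstn_fac | apply Hl; eauto].
Qed.

Lemma complete_incl_trunc t n l l' : complete t n l -> complete t (S n) l' ->
  incl l (map (firstn n) l').
Proof.
  intros [_ Hl] [_ Hl'] u Hu. apply Hl in Hu as [i ->]. rewrite <- firstn_fac.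
  apply in_map, Hl'. eauto.
Qed.

Lemma deterministic_periodic t n i p : 0 < p -> fac t n i = fac t n (i + p) ->
  (forall a b, fac t n a = fac t n b -> fac t (S n) a = fac t (S n) b) -> eventually_periodic t.
Proof.
  intros Hp E D.
  assert (H : forall k, fac t (S n) (i + k) = fac t (S n) (i + k + p)).
  { induction k as [|k IH].
    - rewrite Nat.add_0_r. now apply D.
    - apply D. replace (i + S k) with (i + k + 1) by lia.
      replace (i + k + 1 + p) with (i + k + p + 1) by lia. eapply fac_sub; [exact IH | lia]. }
  exists (i + n), p; split; [easy|]. intros a Ha.
  specialize (H (a - i - n)). apply fac_S in H as [_ H].
  rewrite (ltac:(lia) : i + (a - i - n) + n = a) in H.
  now replace (i + (a - i - n) + p + n) with (a + p) in H by lia.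
Qed.

(** Without growth, truncation from length n + 1 to length n is injective: every factor of length n
    determines the next letter, and a single repeated factor then forces periodicity. *)
Lemma complexity_growth t n l l' : ~ eventually_periodic t ->
  complete t n l -> complete t (S n) l' -> length l < length l'.
Proof.
  intros Hap Hc Hc'. destruct (le_lt_dec (length l') (length l)) as [H|H]; [exfalso | easy].
  apply Hap. destruct (pigeon _ _ _ (S (length l)) Hc) as (i & j & Hij & E); [lia|].
  apply (deterministic_periodic t n i (j - i)); [lia | now replace (i + (j - i)) with j by lia |].
  intros a b Eab.
  assert (Hnd : NoDup (map (firstn n) l')).
  { apply (NoDup_incl_NoDup (l := l)).
    - apply Hc.
    - now rewrite length_map.
    - now apply complete_incl_trunc with t. }
  apply (NoDup_map_inj _ _ _ _ Hnd); [apply Hc'; eauto | apply Hc'; eauto |].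
  now rewrite !firstn_fac.
Qed.

Lemma quasi_complete t K n : quasi t K -> exists l, complete t n l.
Proof.
  intros [n0 H].
  assert (G : forall d m, n0 <= m + d -> exists l, complete t m l).
  { induction d as [|d IH]; intros m Hm.
    - destruct (H m) as (l & Hl & _); [lia | eauto].
    - destruct (IH (S m)) as [l Hl]; [lia|]. eexists. exact (complete_trunc _ _ _ Hl). }
  apply (G n0); lia.
Qed.

Lemma morse_hedlund t n l : ~ eventually_periodic t -> (forall m, exists l, complete t m l) ->
  complete t n l -> n < length l.
Proof.
  intros Hap Hc. revert l; induction n as [|n IH]; intros l Hl.
  - destruct Hl as [_ Hl]. destruct l; [|simpl; lia].
    exfalso. apply (Hl (fac t 0 0)). now exists 0.
  - destruct (Hc n) as [l0 Hl0]. specialize (IH _ Hl0).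
    pose proof (complexity_growth _ _ _ _ Hap Hl0 Hl). lia.
Qed.

(** * Passing to a tail whose prefixes recur *)

Definition tail (m : nat) (t : nat -> nat) : nat -> nat := fun i => t (m + i).

Lemma fac_tail t m n i : fac (tail m t) n i = fac t n (m + i).
Proof.
  unfold fac, tail. revert i; induction n as [|n IH]; intros i; [reflexivity|].
  simpl. rewrite IH. now replace (m + S i) with (S (m + i)) by lia.
Qed.

Definition prefix_recurrent (t : nat -> nat) : Prop :=
  forall n, exists i, 0 < i /\ fac t n i = fac t n 0.

(** Long prefixes now occur at position 0 only, so dropping the first letter removes exactly one
    factor of each large length. *)
Lemma quasi_tail_step t K : quasi t K -> ~ prefix_recurrent t -> quasi (tail 1 t) (K - 1) /\ 1 <= K.
Proof.
  intros HQ Hr. apply not_all_ex_not in Hr as [N HN].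
  assert (HK : 1 <= K).
  { destruct (quasi_complete t K) with (n := 0) as [l0 _]; [easy|].
    destruct (HQ) as [n0 H]. destruct (H n0) as (l & Hc & Hlen); [lia|].
    pose proof (morse_hedlund t n0 l (quasi_aperiodic _ _ HQ) (fun n => quasi_complete t K n HQ) Hc). lia. }
  split; [|easy]. destruct HQ as [n0 H]. exists (n0 + N). intros n Hn.
  destruct (H n) as (l & [Hnd Hl] & Hlen); [lia|].
  assert (Hin : In (fac t n 0) l) by (apply Hl; eauto).
  destruct (in_split _ _ Hin) as (l1 & l2 & ->).
  pose proof (NoDup_remove_1 _ _ _ Hnd) as Hnd1. pose proof (NoDup_remove_2 _ _ _ Hnd) as Hnd2.
  exists (l1 ++ l2). split; [split; [easy|]|].
  - intros u; split.
    + intros Hu. assert (Hu' : In u (l1 ++ fac t n 0 :: l2)).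
      { apply in_app_iff in Hu. apply in_app_iff; simpl; tauto. }
      apply Hl in Hu' as [[|i] ->]; [easy|]. exists i. now rewrite fac_tail.
    + intros [i ->]. rewrite fac_tail.
      assert (Hi : In (fac t n (1 + i)) (l1 ++ fac t n 0 :: l2)) by (apply Hl; eauto).
      apply in_app_iff in Hi. apply in_app_iff. destruct Hi as [Hi|[Hi|Hi]]; [tauto | | tauto].
      exfalso. apply HN. exists (1 + i); split; [lia|]. symmetry. eapply fac_le; [exact Hi | lia].
  - rewrite length_app in *. simpl in Hlen. lia.
Qed.

(** Each deletion lowers the offset, which Morse-Hedlund keeps at least 1; hence finitely many
    deletions suffice. *)
Lemma quasi_recurrent_tail t K : quasi t K ->
  exists m K', quasi (tail m t) K' /\ prefix_recurrent (tail m t).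
Proof.
  revert t. induction K as [|K IH]; intros t HQ.
  - destruct (classic (prefix_recurrent t)) as [H|H].
    + exists 0, 0. now split.
    + apply (quasi_tail_step _ 0) in H; [lia | easy].
  - destruct (classic (prefix_recurrent t)) as [H|H].
    + exists 0, (S K). now split.
    + destruct (quasi_tail_step _ _ HQ H) as [HQ' _].
      replace (S K - 1) with K in HQ' by lia. destruct (IH _ HQ') as (m & K' & H1 & H2).
      exists (S m), K'. now split.
Qed.

(** * First repetitions *)

Definition complexity_from (t : nat -> nat) (K n0 : nat) : Prop :=
  forall n, n0 <= n -> exists l, complete t n l /\ length l = n + K.

(* w is the first position whose factor of length n has occurred before, namely at u, and n is
   maximal for this pair of positions. *)
Definition plateau (t : nat -> nat) (u w n : nat) : Prop :=
  u < w /\ (forall i j, i < j < w -> fac t n i <> fac t n j) /\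
  fac t n u = fac t n w /\ t (u + n) <> t (w + n).

Lemma plateau_break t u w n : plateau t u w n -> fac t (S n) u <> fac t (S n) w.
Proof. intros (_ & _ & _ & H) E. now apply fac_S in E as [_ E]. Qed.

(** The complexity grows by exactly one from n to n + 1. Without the factor at w, the factors of
    length n + 1 still truncate onto all factors of length n, because u and w share theirs; the two
    lists now have equal length, so truncation is injective. *)
Lemma extension_unique t K n0 n u w i j : complexity_from t K n0 -> n0 <= n ->
  fac t n u = fac t n w -> fac t (S n) u <> fac t (S n) w -> fac t n i = fac t n j ->
  fac t (S n) i <> fac t (S n) w -> fac t (S n) j <> fac t (S n) w -> fac t (S n) i = fac t (S n) j.
Proof.
  intros HK Hn Euw Huw Eij Hi Hj.
  destruct (HK n) as (l & Hl & Hlen); [easy|].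
  destruct (HK (S n)) as (l' & Hl' & Hlen'); [lia|].
  assert (Hw : In (fac t (S n) w) l') by (apply Hl'; eauto).
  destruct (in_split _ _ Hw) as (l1 & l2 & ->).
  assert (Hin : forall k, fac t (S n) k <> fac t (S n) w -> In (fac t (S n) k) (l1 ++ l2)).
  { intros k Hk. assert (H : In (fac t (S n) k) (l1 ++ fac t (S n) w :: l2)) by (apply Hl'; eauto).
    apply in_app_iff in H. apply in_app_iff. destruct H as [H|[H|H]]; [tauto | congruence | tauto]. }
  assert (Hnd : NoDup (map (firstn n) (l1 ++ l2))).
  { apply (NoDup_incl_NoDup (l := l)).
    - apply Hl.
    - rewrite length_map. rewrite length_app in *. simpl in Hlen'. lia.
    - intros x Hx. apply Hl in Hx as [k ->].
      destruct (classic (fac t (S n) k = fac t (S n) w)) as [E|E].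
      + apply fac_S in E as [E _]. rewrite E, <- Euw, <- firstn_fac. apply in_map, Hin, Huw.
      + rewrite <- firstn_fac. now apply in_map, Hin. }
  apply (NoDup_map_inj _ _ _ _ Hnd); [auto | auto | now rewrite !firstn_fac].
Qed.

Lemma plateau_special t K n0 n u w i j : complexity_from t K n0 -> n0 <= n ->
  plateau t u w n -> fac t n i = fac t n j -> fac t (S n) i <> fac t (S n) j -> fac t n i = fac t n u.
Proof.
  intros HK Hn HP Eij Hij. pose proof (plateau_break _ _ _ _ HP) as Hb.
  destruct HP as (_ & _ & Euw & _).
  destruct (classic (fac t (S n) i = fac t (S n) w)) as [E|E].
  - apply fac_S in E as [E _]. congruence.
  - destruct (classic (fac t (S n) j = fac t (S n) w)) as [E'|E'].
    + apply fac_S in E' as [E' _]. congruence.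
    + destruct Hij. now apply (extension_unique t K n0 n u w).
Qed.

(** Let w' be the position of the first repetition of length n + 1. The positions before w' carry
    distinct factors of that length and exhaust them all, which fixes w' as the complexity n + 1 +
    K. At length n, these positions without w exhaust n + K factors and are again distinct. *)
Lemma plateau_structure t K n0 n u w : complexity_from t K n0 -> n0 <= n -> plateau t u w n ->
  (forall i, exists i', i' < n + S K /\ fac t (S n) i = fac t (S n) i') /\
  (forall i j, i < j < n + S K -> fac t n i = fac t n j -> i = u /\ j = w) /\
  w < n + S K.
Proof.
  intros HK Hn HP. pose proof (plateau_break _ _ _ _ HP) as Hb.
  pose proof HP as (Huw & Hd & Euw & _).
  destruct (HK (S n)) as (l' & Hl' & Hlen'); [lia|].
  destruct (HK n) as (l & Hl & Hlen); [lia|].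
  destruct (min_ex (fun w' => exists u', u' < w' /\ fac t (S n) u' = fac t (S n) w'))
    as (w' & (u' & Hu' & E') & Hmin).
  { destruct (pigeon _ _ _ (S (length l')) Hl') as (a & c & Hac & E); [lia|].
    exists c, a; split; [lia | easy]. }
  assert (Hd' : forall i j, i < j < w' -> fac t (S n) i <> fac t (S n) j).
  { intros i j Hij E. apply (Hmin j); [lia|]. exists i; split; [lia | easy]. }
  assert (Hww : w < w').
  { destruct (lt_eq_lt_dec w w') as [[H|H]|H]; [easy | exfalso | exfalso].
    - subst w'. pose proof E' as E. apply fac_S in E as [E _].
      destruct (lt_eq_lt_dec u u') as [[H|H]|H].
      + apply (Hd u u'); [lia | congruence].
      + subst u'. easy.
      + apply (Hd u' u); [lia | congruence].
    - apply fac_S in E' as [E _]. apply (Hd u' w'); [lia | easy]. }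
  (* The positions below w' are closed under moving to the right: w' leads back to u', and the
     extension is ambiguous only for the special factor, whose two extensions sit at u and w. *)
  assert (Hall : forall i, exists i', i' < w' /\ fac t (S n) i = fac t (S n) i').
  { induction i as [|i (i' & Hi' & E)]; [exists 0; split; [lia | easy]|].
    assert (Hj : exists j, j < w' /\ fac t n (S i) = fac t n j).
    { assert (E1 : fac t n (S i) = fac t n (S i')).
      { now apply fac_succ. }
      destruct (Nat.eq_dec (S i') w') as [Ew|Ew].
      - exists u'; split; [easy|]. apply fac_S in E' as [E' _]. congruence.
      - exists (S i'); split; [lia | easy]. }
    destruct Hj as (j & Hj & Ej).
    destruct (classic (fac t (S n) (S i) = fac t (S n) j)) as [H|H]; [eauto|].
    destruct (classic (fac t (S n) (S i) = fac t (S n) w)) as [Hw|Hw]; [eauto|].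
    exists u; split; [lia|].
    destruct (classic (fac t (S n) j = fac t (S n) w)) as [Hjw|Hjw].
    - apply fac_S in Hjw as [Hjw _].
      apply (extension_unique t K n0 n u w); auto. congruence.
    - destruct H. now apply (extension_unique t K n0 n u w). }
  assert (Hw' : w' = n + S K).
  { assert (Hnd : NoDup (map (fac t (S n)) (seq 0 w'))).
    { apply NoDup_map_NoDup_ForallPairs; [|apply seq_NoDup].
      intros i j Hi Hj E. apply in_seq in Hi, Hj.
      destruct (lt_eq_lt_dec i j) as [[H|]|H]; [|easy|]; exfalso.
      - apply (Hd' i j); [lia | easy].
      - apply (Hd' j i); [lia | easy]. }
    apply NoDup_incl_length with (l' := l') in Hnd.
    2:{ intros x Hx. apply in_map_iff in Hx as (i & <- & _). apply Hl'. eauto. }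
    destruct Hl' as [Hnd' Hl'].
    apply NoDup_incl_length with (l' := map (fac t (S n)) (seq 0 w')) in Hnd'.
    2:{ intros x Hx. apply Hl' in Hx as [i ->]. destruct (Hall i) as (i' & Hi' & ->).
        apply in_map, in_seq. lia. }
    rewrite length_map, length_seq in *. lia. }
  rewrite <- Hw'. split; [easy|]. split; [|easy].
  set (q := seq 0 w ++ seq (S w) (w' - w - 1)).
  assert (Hq : forall i, In i q <-> i < w' /\ i <> w).
  { intros i. unfold q. rewrite in_app_iff, !in_seq. lia. }
  assert (Hnd : NoDup (map (fac t n) q)).
  { apply (NoDup_incl_NoDup (l := l)).
    - apply Hl.
    - rewrite length_map. unfold q. rewrite length_app, !length_seq. lia.
    - intros x Hx. apply Hl in Hx as [i ->]. destruct (Hall i) as (i' & Hi' & E).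
      apply fac_S in E as [-> _]. destruct (Nat.eq_dec i' w) as [->|H].
      + rewrite <- Euw. apply in_map, Hq. lia.
      + apply in_map, Hq. lia. }
  intros i j Hij E.
  destruct (Nat.eq_dec j w) as [->|Hjw].
  { split; [|easy]. destruct (lt_eq_lt_dec i u) as [[H|]|H]; [exfalso | easy | exfalso].
    - apply (Hd i u); [lia | congruence].
    - apply (Hd u i); [lia | congruence]. }
  exfalso. destruct (Nat.eq_dec i w) as [->|Hiw].
  - assert (u = j); [|lia]. apply (NoDup_map_inj _ _ _ _ Hnd); [apply Hq; lia | apply Hq; lia | congruence].
  - assert (i = j); [|lia]. apply (NoDup_map_inj _ _ _ _ Hnd); [apply Hq; lia | apply Hq; lia | easy].
Qed.

Lemma plateau_extend t u w n : ~ eventually_periodic t -> u < w ->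
  (forall i j, i < j < w -> fac t n i <> fac t n j) -> fac t n u = fac t n w ->
  exists n', n <= n' /\ plateau t u w n'.
Proof.
  intros Hap Huw Hd E.
  destruct (min_ex (fun m => t (u + m) <> t (w + m))) as (m & Hm & Hmin).
  { apply NNPP. intros H. apply Hap. exists u, (w - u). split; [lia|].
    intros i Hi. apply NNPP. intros H'. apply H. exists (i - u).
    replace (u + (i - u)) with i by lia. now replace (w + (i - u)) with (i + (w - u)) by lia; auto. }
  assert (Hnm : n <= m).
  { destruct (le_lt_dec n m) as [|H]; [easy|]. exfalso. apply Hm. now apply (proj1 (fac_eq t n u w) E). }
  exists m. split; [easy|]. split; [easy|]. split; [|split; [|easy]].
  - intros i j Hij H. apply (Hd i j Hij). now apply fac_le with m.
  - apply fac_eq. intros k Hk. apply NNPP. now apply Hmin.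
Qed.

Lemma plateau_exists t K n0 n : complexity_from t K n0 -> ~ eventually_periodic t -> n0 <= n ->
  exists u w n', n <= n' /\ plateau t u w n'.
Proof.
  intros HK Hap Hn. destruct (HK n Hn) as (l & Hl & _).
  destruct (min_ex (fun w' => exists u', u' < w' /\ fac t n u' = fac t n w'))
    as (w & (u & Hu & E) & Hmin).
  { destruct (pigeon _ _ _ (S (length l)) Hl) as (a & c & Hac & E); [lia|].
    exists c, a; split; [lia | easy]. }
  destruct (plateau_extend t u w n Hap Hu) as (n' & Hn' & HP); [|easy|eauto].
  intros i j Hij Eij. apply (Hmin j); [lia|]. exists i; split; [lia | easy].
Qed.

Lemma plateau_next t K n0 n u w : complexity_from t K n0 -> ~ eventually_periodic t -> n0 <= n ->
  plateau t u w n -> exists u' n', n < n' /\ plateau t u' (n + S K) n'.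
Proof.
  intros HK Hap Hn HP. pose proof (plateau_break _ _ _ _ HP) as Hb.
  destruct (plateau_structure _ _ _ _ _ _ HK Hn HP) as (H1 & H2 & H3).
  destruct (H1 (n + S K)) as (u' & Hu' & E).
  destruct (plateau_extend t u' (n + S K) (S n) Hap Hu') as (n' & Hn' & HP'); [|easy|].
  - intros i j Hij Eij. pose proof Eij as E'. apply fac_S in E' as [E' _].
    destruct (H2 _ _ Hij E') as [-> ->]. easy.
  - exists u', n'. split; [lia | easy].
Qed.

(* Every position < n + S K is reached by an edge of the Rauzy graph of order n out of an
   earlier position, and only the right special vertex fac t n u is visited twice; if u > 0, the
   initial vertex can thus only recur at the very end of this walk. *)
Lemma plateau_next_zero t K n0 n u w : complexity_from t K n0 -> ~ eventually_periodic t ->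
  prefix_recurrent t -> n0 <= n -> 0 < u -> plateau t u w n ->
  exists n', n < n' /\ plateau t 0 (n + S K) n'.
Proof.
  intros HK Hap Hr Hn Hu HP. pose proof (plateau_break _ _ _ _ HP) as Hb.
  destruct (plateau_structure _ _ _ _ _ _ HK Hn HP) as (H1 & H2 & H3).
  destruct (Hr n) as ([|i] & Hi & E); [lia|].
  destruct (H1 i) as (i' & Hi' & E').
  assert (Ei : fac t n (S i') = fac t n 0).
  { rewrite <- E. symmetry. now apply fac_succ. }
  destruct (Nat.eq_dec (S i') (n + S K)) as [Ew|Ew].
  2:{ destruct (H2 0 (S i')); [lia | easy | lia]. }
  rewrite Ew in Ei.
  assert (E0 : fac t (S n) 0 = fac t (S n) (n + S K)).
  { apply NNPP. intros H. assert (fac t n 0 = fac t n u) as E0.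
    { apply (plateau_special t K n0 n u w 0 (n + S K)); auto. }
    destruct HP as (Huw & Hd & _). apply (Hd 0 u); [lia | easy]. }
  destruct (plateau_extend t 0 (n + S K) (S n) Hap) as (n' & Hn' & HP'); [lia | | easy |].
  - intros a c Hac Eac. pose proof Eac as E1. apply fac_S in E1 as [E1 _].
    destruct (H2 _ _ Hac E1) as [-> ->]. easy.
  - exists n'. split; [lia | easy].
Qed.

Lemma plateau_occurrence t u w n i : plateau t u w n -> fac t n i = fac t n u -> i = u \/ w <= i.
Proof.
  intros (Huw & Hd & _) E. destruct (le_lt_dec w i) as [|H]; [now right | left].
  destruct (lt_eq_lt_dec i u) as [[H1|]|H1]; [exfalso | easy | exfalso].
  - apply (Hd i u); [lia | easy].
  - apply (Hd u i); [lia | easy].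
Qed.

(* Since fac t n u is the only right special factor of its length, it is a suffix of the longer
   right special factor fac t n' u'. *)
Lemma plateau_suffix t K n0 u w n u' w' n' : complexity_from t K n0 -> n0 <= n ->
  plateau t u w n -> plateau t u' w' n' -> n <= n' ->
  fac t n (u' + (n' - n)) = fac t n u /\ fac t n (w' + (n' - n)) = fac t n u.
Proof.
  intros HK Hn HP (Hu' & _ & E' & Hb') Hnn.
  assert (E : fac t n (u' + (n' - n)) = fac t n (w' + (n' - n))) by (eapply fac_sub; [exact E' | lia]).
  assert (fac t n (u' + (n' - n)) = fac t n u); [|split; congruence].
  apply (plateau_special t K n0 n u w _ (w' + (n' - n))); auto.
  intros H. apply fac_S in H as [_ H]. apply Hb'.
  replace (u' + n') with (u' + (n' - n) + n) by lia. now replace (w' + n') with (w' + (n' - n) + n) by lia.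
Qed.

Lemma plateau_left t u w n : plateau t u w n -> 0 < u -> t (u - 1) <> t (w - 1).
Proof.
  intros (Huw & Hd & E & _) Hu H. apply (Hd (u - 1) (w - 1)); [lia|].
  apply fac_le with (S n); [|lia]. apply fac_eq. intros [|k] Hk.
  - now rewrite !Nat.add_0_r.
  - replace (u - 1 + S k) with (u + k) by lia. replace (w - 1 + S k) with (w + k) by lia.
    apply (proj1 (fac_eq t n u w) E). lia.
Qed.

(* A left special vertex of the Rauzy graph of order n must be fac t n u, so the bispecial factor
   fac t n u is a prefix of the bispecial factor fac t n' u'. *)
Lemma plateau_prefix t K n0 u w n nZ u' w' n' : complexity_from t K n0 -> n0 <= n ->
  plateau t u w n -> 0 < u -> n < nZ -> plateau t 0 (n + S K) nZ ->
  plateau t u' w' n' -> 0 < u' -> n < n' ->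
  fac t n u' = fac t n u /\ fac t n w' = fac t n u.
Proof.
  intros HK Hn HP Hu HnZ HZ HP' Hu' Hnn.
  destruct (plateau_structure _ _ _ _ _ _ HK Hn HP) as (H1 & H2 & H3).
  pose proof (plateau_left _ _ _ _ HP' Hu') as Hl.
  assert (Euw : fac t n u' = fac t n w') by (apply fac_le with n'; [apply HP' | lia]).
  assert (E0 : fac t n 0 = fac t n (n + S K)) by (apply fac_le with nZ; [apply HZ | lia]).
  assert (Huw' : u' < w') by apply HP'.
  destruct (H1 (u' - 1)) as (i & Hi & Ei), (H1 (w' - 1)) as (j & Hj & Ej).
  assert (Ei1 : fac t n u' = fac t n (S i)).
  { replace u' with (S (u' - 1)) by lia. now apply fac_succ. }
  assert (Ej1 : fac t n w' = fac t n (S j)).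
  { replace w' with (S (w' - 1)) by lia. now apply fac_succ. }
  assert (Hij : i <> j).
  { intros ->. apply Hl. rewrite <- Ej in Ei. apply (proj1 (fac_eq t (S n) _ _)) with (k := 0) in Ei; [|lia].
    now rewrite !Nat.add_0_r in Ei. }
  assert (fac t n u' = fac t n u); [|split; congruence].
  assert (G : forall a c, a < n + S K -> c < n + S K -> a < c -> fac t n (S a) = fac t n (S c) ->
    S a = u \/ S c = u).
  { intros a c Ha Hc Hac E.
    destruct (Nat.eq_dec (S c) (n + S K)) as [Ec|Ec].
    - destruct (H2 0 (S a)); [lia | rewrite E, Ec; congruence | lia].
    - destruct (H2 (S a) (S c)); [lia | easy | lia]. }
  destruct (lt_eq_lt_dec i j) as [[H|H]|H]; [| lia |].
  - destruct (G i j) as [E|E]; [lia | lia | lia | congruence | congruence | congruence].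
  - destruct (G j i) as [E|E]; [lia | lia | lia | congruence | congruence | congruence].
Qed.

(** * The recursion satisfied by the first repetitions *)

Definition period (f : nat -> nat) (L p : nat) : Prop := forall i, i + p < L -> f i = f (i + p).

Lemma period_mult f L p m : period f L p -> period f L (m * p).
Proof.
  intros H. induction m as [|m IH]; intros i Hi; simpl in *.
  - now rewrite Nat.add_0_r.
  - rewrite IH by lia. rewrite (H (i + m * p)) by lia. f_equal. lia.
Qed.

(** The weak form of the Fine-Wilf theorem, along the subtractive Euclidean algorithm. *)
Lemma period_gcd f L p q : period f L p -> period f L q -> p + q <= L -> period f L (Nat.gcd p q).
Proof.
  remember (p + q) as s eqn:Es. revert p q Es.
  induction s as [s IH] using lt_wf_ind. intros p q -> Hp Hq HL.
  assert (G : forall p q, p + q <= L -> p <= q -> period f L p -> period f L q -> period f L (q - p)).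
  { clear. intros p q HL Hpq Hp Hq i Hi. destruct (lt_dec (i + q) L) as [H|H].
    - rewrite (Hq i) by lia. symmetry. rewrite (Hp (i + (q - p))) by lia. f_equal. lia.
    - transitivity (f (i - p)).
      + symmetry. rewrite (Hp (i - p)) by lia. f_equal. lia.
      + rewrite (Hq (i - p)) by lia. f_equal. lia. }
  destruct (Nat.eq_dec p 0) as [->|Hp0]; [easy|].
  destruct (Nat.eq_dec q 0) as [->|Hq0]; [now rewrite Nat.gcd_0_r|].
  destruct (le_lt_dec p q) as [H|H].
  - replace q with ((q - p) + p) by lia. rewrite <- (Nat.mul_1_l p) at 3. rewrite Nat.gcd_add_mult_diag_r.
    apply (IH (p + (q - p))); [lia | easy | easy | now apply G | lia].
  - rewrite Nat.gcd_comm. replace p with ((p - q) + q) by lia.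
    rewrite <- (Nat.mul_1_l q) at 3. rewrite Nat.gcd_add_mult_diag_r.
    apply (IH (q + (p - q))); [lia | easy | easy | apply G; [lia | lia | easy | easy] | lia].
Qed.

(** Otherwise gcd (v, p) < v would be a period as well, and the factor at u would already recur
    before u + v. *)
Lemma plateau_period_divides t u v n p : plateau t u (u + v) n -> 0 < v -> v + p <= n ->
  period (fun i => t (u + i)) n p -> Nat.divide v p.
Proof.
  intros (_ & Hd & E & _) Hv Hle Hp.
  assert (Hper : period (fun i => t (u + i)) n v).
  { intros i Hi. rewrite (proj1 (fac_eq _ _ _ _) E) by lia. f_equal. lia. }
  pose proof (period_gcd _ _ _ _ Hper Hp Hle) as Hg.
  destruct (Nat.gcd_divide_l v p) as [m Hm].
  set (g := Nat.gcd v p) in *.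
  destruct (Nat.eq_dec g v) as [Egv|Egv].
  { rewrite <- Egv. apply Nat.gcd_divide_r. }
  assert (Hm2 : 2 <= m) by (destruct m as [|[|m]]; lia).
  assert (Hg0 : 0 < g) by nia.
  exfalso. apply (Hd u (u + g)); [nia|].
  apply fac_eq. intros k Hk. destruct (lt_dec (k + g) n) as [H|H].
  - rewrite <- Nat.add_assoc, (Nat.add_comm g). now apply Hg.
  - assert (Hvg : v - g = (m - 1) * g) by nia.
    assert (Hgv : g < v) by nia.
    (* The letter at u + g + k lies outside the factor at u, but inside its copy at u + v. *)
    transitivity (t (u + (k - (v - g)))).
    + symmetry. pose proof (period_mult _ _ _ (m - 1) Hg (k - (v - g))) as Hx. simpl in Hx.
      rewrite Hx by lia. f_equal. lia.
    + rewrite (proj1 (fac_eq _ _ _ _) E) by lia. f_equal. lia.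
Qed.

(* The numerical bound 151 / 100 is slightly larger than bound_const - 1. *)
Definition slow (t : nat -> nat) (K n1 : nat) : Prop :=
  complexity_from t K n1 /\ ~ eventually_periodic t /\ prefix_recurrent t /\
  (forall u w n, n1 <= n -> plateau t u w n -> 100 * (n + S K) <= 151 * w) /\
  100 * S K <= n1.

(** If u' were 0, the special prefix of length n would occur at n' - n > 0, hence not before w. Then
    n' >= n + w, a growth by about 1 + 100 / 151, which exceeds 151 / 100. *)
Lemma slow_after_zero t K n1 w n u' n' : slow t K n1 -> n1 <= n -> n < n' ->
  plateau t 0 w n -> plateau t u' (n + S K) n' -> 0 < u'.
Proof.
  intros (HK & Hap & Hrec & Hr & Hbig) Hn Hnn HP HP'.
  destruct (Nat.eq_dec u' 0) as [->|]; [exfalso | lia].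
  destruct (plateau_suffix _ _ _ _ _ _ _ _ _ HK Hn HP HP') as [E _]; [lia|].
  pose proof (Hr _ _ _ Hn HP). assert (Hn' : n1 <= n') by lia. pose proof (Hr _ _ _ Hn' HP').
  destruct (plateau_occurrence _ _ _ _ _ HP E); lia.
Qed.

(** The special factor at u is a suffix of the next special prefix, of length n', so it occurs at n'
    - n. This is u or at least w, and the latter is again too much growth. *)
Lemma slow_after_pos t K n1 u w n : slow t K n1 -> n1 <= n -> 0 < u -> plateau t u w n ->
  plateau t 0 (n + S K) (n + u).
Proof.
  intros (HK & Hap & Hrec & Hr & Hbig) Hn Hu HP.
  destruct (plateau_next_zero _ _ _ _ _ _ HK Hap Hrec Hn Hu HP) as (n' & Hnn & HP').
  destruct (plateau_suffix _ _ _ _ _ _ _ _ _ HK Hn HP HP') as [E _]; [lia|].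
  pose proof (Hr _ _ _ Hn HP). assert (Hn' : n1 <= n') by lia. pose proof (Hr _ _ _ Hn' HP').
  destruct (plateau_occurrence _ _ _ _ _ HP E) as [Hx|Hx]; [|lia].
  now replace (n + u) with n' by lia.
Qed.

(* Three consecutive plateaus with repetitions starting inside, at the beginning of, and again
   inside the word; z and u + v are the w-values of the last two. *)
Definition state (t : nat -> nat) (K n1 z u v : nat) : Prop :=
  exists uh wh nh nk, n1 <= nh /\ 0 < uh /\ plateau t uh wh nh /\ z = nh + S K /\
    plateau t 0 z (nh + uh) /\ 0 < u /\ u + v = z + uh /\ nh + uh < nk /\ plateau t u (u + v) nk.

Lemma state_from_pos t K n1 u w n : slow t K n1 -> n1 <= n -> 0 < u -> plateau t u w n ->
  exists z u' v', state t K n1 z u' v'.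
Proof.
  intros Hs Hn Hu HP. pose proof (slow_after_pos _ _ _ _ _ _ Hs Hn Hu HP) as HZ.
  pose proof Hs as (HK & Hap & _).
  destruct (plateau_next t K n1 (n + u) 0 (n + S K)) as (u' & n' & Hn' & HP'); auto; [lia|].
  assert (Hu' : 0 < u').
  { apply (slow_after_zero t K n1 (n + S K) (n + u) u' n'); auto. lia. }
  exists (n + S K), u', (n + u + S K - u'), u, w, n, n'.
  assert (u' < n + u + S K) by apply HP'.
  do 8 (split; [first [easy | lia] |]). now replace (u' + (n + u + S K - u')) with (n + u + S K) by lia.
Qed.

Lemma state_exists t K n1 : slow t K n1 -> exists z u v, state t K n1 z u v.
Proof.
  intros Hs. pose proof Hs as (HK & Hap & _).
  destruct (plateau_exists t K n1 n1 HK Hap) as (u & w & n & Hn & HP); [lia|].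
  destruct (Nat.eq_dec u 0) as [->|Hu].
  - destruct (plateau_next t K n1 n 0 w) as (u' & n' & Hn' & HP'); auto.
    assert (Hu' : 0 < u') by now apply (slow_after_zero t K n1 w n u' n').
    apply (state_from_pos t K n1 u' (n + S K) n'); auto. lia.
  - apply (state_from_pos t K n1 u w n); auto. lia.
Qed.

Lemma state_step t K n1 z u v x : slow t K n1 ->
  (forall u w n, n1 <= n -> plateau t u w n -> (INR (n + S K) <= x * INR w)%R) ->
  state t K n1 z u v ->
  exists j, state t K n1 (z + S j * v) (u + v) (z + j * v) /\ u + v < z + S j * v /\
    (INR (z + S j * v) <= x * INR (u + v))%R.
Proof.
  intros Hs Hxr (uh & wh & nh & nk & Hnh & Huh & Hh & Ez & Hi & Hu & Ek & Hnk & Hk).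
  pose proof Hs as (HK & Hap & Hrec & Hr & Hbig).
  assert (Hnk1 : n1 <= nk) by lia.
  assert (Huv : u < u + v) by apply Hk.
  pose proof (slow_after_pos _ _ _ _ _ _ Hs Hnk1 Hu Hk) as Hl.
  assert (Hwk : u + v < nk + S K) by now apply (plateau_structure _ _ _ _ _ _ HK Hnk1 Hk).
  destruct (plateau_next t K n1 (nk + u) 0 (nk + S K)) as (um & nm & Hnm & Hm); auto; [lia|].
  assert (Hum : 0 < um).
  { apply (slow_after_zero t K n1 (nk + S K) (nk + u) um nm); auto. lia. }
  assert (Huwm : um < nk + u + S K) by apply Hm.
  assert (Ekv : fac t nk u = fac t nk (u + v)) by apply Hk.
  (* The prefix of length nh + uh occurs at nk + S K. Going back by multiples of v through the
     periodic stretch from u leads to an occurrence t0 in [u, u + v). It cannot precede z, and t0 >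
     z would make the prefix of length nh recur at t0 - z < uh. *)
  assert (Hz' : exists j, nk + S K = z + S j * v).
  { assert (G : forall p, u <= p <= nk + S K -> fac t (nh + uh) p = fac t (nh + uh) 0 ->
      exists t0 j, u <= t0 < u + v /\ fac t (nh + uh) t0 = fac t (nh + uh) 0 /\ p = t0 + j * v).
    { induction p as [p IH] using lt_wf_ind. intros Hp Ep.
      destruct (lt_dec p (u + v)) as [H|H].
      - exists p, 0. split; [lia|]. split; [easy | lia].
      - destruct (IH (p - v)) as (t0 & j & H1 & H2 & H3); [lia | lia | | ].
        + rewrite <- Ep. replace (p - v) with (u + (p - v - u)) by lia.
          replace p with (u + v + (p - v - u)) at 2 by lia. eapply fac_sub; [exact Ekv | lia].
        + exists t0, (S j). split; [easy|]. split; [easy | nia]. }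
    assert (Hni1 : n1 <= nh + uh) by lia.
    destruct (plateau_suffix _ _ _ _ _ _ _ _ _ HK Hni1 Hi Hk) as [_ E]; [lia|].
    replace (u + v + (nk - (nh + uh))) with (nk + S K) in E by lia.
    destruct (G (nk + S K)) as (t0 & j & Ht0 & E0 & Ej); [lia | easy |].
    destruct (plateau_occurrence _ _ _ _ _ Hi E0) as [H|H]; [lia|].
    assert (t0 = z); [|subst t0; destruct j as [|j]; [lia | now exists j]].
    destruct (Nat.eq_dec t0 z) as [|Hne]; [easy | exfalso].
    destruct Hh as (Huwh & Hdh & _). apply (Hdh 0 (t0 - z)); [lia|].
    assert (Ei : fac t (nh + uh) 0 = fac t (nh + uh) z) by apply Hi.
    transitivity (fac t nh t0).
    - symmetry. apply fac_le with (nh + uh); [easy | lia].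
    - symmetry. replace t0 with (z + (t0 - z)) at 2 by lia.
      replace (t0 - z) with (0 + (t0 - z)) at 1 by lia. eapply fac_sub; [exact Ei | lia]. }
  destruct Hz' as [j Hj]. exists j.
  assert (Hv : S K <= v).
  { pose proof (Hr _ _ _ Hnk1 Hk). assert (Hy : n1 <= nk + u) by lia. pose proof (Hr _ _ _ Hy Hl). lia. }
  destruct (plateau_prefix t K n1 u (u + v) nk (nk + u) um (nk + u + S K) nm) as [Eum Ewm]; auto; try lia.
  assert (Hu' : um = u + v).
  { destruct (plateau_occurrence _ _ _ _ _ Hk Eum) as [->|Hge].
    (* Starting again at u would prolong the repetition of the prefix beyond its length nk + u. *)
    - exfalso. destruct Hl as (_ & _ & _ & Hb). apply Hb. destruct Hm as (_ & _ & Em & _).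
      pose proof (proj1 (fac_eq _ _ _ _) Em nk) as Hx.
      replace (0 + (nk + u)) with (u + nk) by lia. replace (nk + S K + (nk + u)) with (nk + u + S K + nk) by lia.
      apply Hx. lia.
    - destruct (Nat.eq_dec um (u + v)) as [|Hne]; [easy | exfalso].
      (* The factor of length nk at u has the periods v, D and vm, with v + D + vm = nk + S K.
         Either D or vm is short enough for divisibility by v: vm would then be smaller than v, and
         v dividing D equates the two letters on which the plateau at u breaks. *)
      set (D := um - (u + v)). set (vm := nk + u + S K - um).
      assert (HD : um = u + v + D) by (unfold D; lia).
      assert (Hsum : v + D + vm = nk + S K) by (unfold D, vm; lia).
      assert (Rk : forall i, i < nk -> t (u + v + i) = t (u + i)).
      { intros i Hlt. symmetry. now apply (proj1 (fac_eq _ _ _ _) Ekv). }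
      assert (Ru : forall i, i < nk -> t (um + i) = t (u + i)).
      { intros i Hlt. now apply (proj1 (fac_eq _ _ _ _) Eum). }
      assert (Rw : forall i, i < nk -> t (um + vm + i) = t (u + i)).
      { intros i Hlt. replace (um + vm) with (nk + u + S K) by (unfold vm; lia).
        now apply (proj1 (fac_eq _ _ _ _) Ewm). }
      assert (PD : period (fun i => t (u + i)) nk D).
      { intros i Hlt. rewrite <- (Ru i) by lia. rewrite <- (Rk (i + D)) by lia. f_equal. lia. }
      assert (Pm : period (fun i => t (u + i)) nk vm).
      { intros i Hlt. rewrite <- (Rw i) by lia. rewrite <- (Ru (i + vm)) by lia. f_equal. lia. }
      assert (Hdiv : Nat.divide v D).
      { destruct (le_lt_dec (S K) vm) as [H|H].
        - apply (plateau_period_divides t u v nk); auto; lia.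
        - assert (Hx : Nat.divide v vm) by (apply (plateau_period_divides t u v nk); auto; lia).
          apply Nat.divide_pos_le in Hx; unfold vm in *; lia. }
      destruct Hdiv as [m Hm'].
      assert (Hm1 : 1 <= m) by (destruct m; lia).
      destruct Hk as (_ & _ & _ & Hb). apply Hb.
      assert (HDn : D <= nk) by lia. assert (Hvn : v <= nk) by lia.
      replace (u + nk) with (u + v + (nk - v)) by lia. rewrite Rk by lia.
      replace (u + v + nk) with (um + (nk - D)) by lia. rewrite Ru by lia.
      assert (Pv : period (fun i => t (u + i)) nk v).
      { intros i Hlt. rewrite <- (Rk i) by lia. f_equal. lia. }
      pose proof (period_mult _ _ _ (m - 1) Pv (nk - D)) as Hx. cbv beta in Hx.
      rewrite Hx by nia. f_equal. f_equal. nia. }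
  subst um. split; [|split; [lia | rewrite <- Hj; now apply (Hxr u)]].
  exists u, (u + v), nk, nm.
  split; [easy|]. split; [easy|]. split; [easy|]. split; [lia|].
  split; [now rewrite <- Hj|]. split; [lia|]. split; [lia|]. split; [lia|].
  now replace (u + v + (z + j * v)) with (nk + u + S K) by lia.
Qed.

Lemma state_bounds t K n1 z u v x :
  (forall u w n, n1 <= n -> plateau t u w n -> (INR (n + S K) <= x * INR w)%R) ->
  state t K n1 z u v ->
  0 < u /\ 0 < v /\ z < u + v /\ (INR (u + v) <= x * INR z)%R.
Proof.
  intros Hx (uh & wh & nh & nk & Hnh & Huh & Hh & Ez & Hi & Hu & Ek & Hnk & Hk).
  assert (Huv : u < u + v) by apply Hk.
  split; [easy|]. split; [lia|]. split; [lia|].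
  replace (u + v) with (nh + uh + S K) by lia. apply (Hx 0 z); [lia | easy].
Qed.

Open Scope R_scope.

(** * Orbits of the recursion *)

(* The two cases j = 0 and j = 1 of the recursion. *)
Definition stepA (St : R -> R -> R -> Prop) z u v := St (z + v) (u + v) z.
Definition stepB (St : R -> R -> R -> Prop) z u v := St (z + 2 * v) (u + v) (z + v).

Definition orbit_closed (St : R -> R -> R -> Prop) (x : R) : Prop :=
  (forall z u v, St z u v -> 0 < z /\ 0 < u /\ 0 < v /\ z < u + v /\ u + v <= x * z) /\
  (forall z u v, St z u v -> exists j : nat,
     St (z + (INR j + 1) * v) (u + v) (z + INR j * v) /\
     u + v < z + (INR j + 1) * v /\ z + (INR j + 1) * v <= x * (u + v)).

(** These inequalities hold after two steps and persist; [z <= 2 * v] is what excludes j >= 2. *)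
Definition tame (St : R -> R -> R -> Prop) z u v : Prop :=
  St z u v /\ v < z /\ z <= 2 * v /\ 100 * z <= 151 * u.

(** By [tame_step] the next two steps can only be A, A: the start of a block AAB. *)
Definition tight (St : R -> R -> R -> Prop) z u v : Prop :=
  tame St z u v /\ ~ stepB (tame St) z u v /\ ~ stepA (stepB (tame St)) z u v.

Lemma bound_const_lt : bound_const - 1 < 151 / 100.
Proof.
  unfold bound_const. pose proof (sqrt_sqrt 10). pose proof (sqrt_pos 10). nra.
Qed.

Lemma orbit_bounds St x z u v : x < 151 / 100 -> orbit_closed St x -> St z u v ->
  0 < z /\ 0 < u /\ 0 < v /\ z < u + v /\ 100 * (u + v) <= 151 * z.
Proof.
  intros Hx [H _] HS. apply H in HS as (Hz & Hu & Hv & Hzu & Hxz). repeat split; try easy. nra.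
Qed.

Lemma tame_step St x z u v : x < 151 / 100 -> orbit_closed St x -> tame St z u v ->
  stepA (tame St) z u v \/ stepB (tame St) z u v.
Proof.
  intros Hx Ho (HS & H1 & H2 & H3).
  pose proof (orbit_bounds _ _ _ _ _ Hx Ho HS) as (Hz & Hu & Hv & Hzu & Hc).
  destruct (proj2 Ho _ _ _ HS) as (j & HS' & Hlt & Hle).
  assert (Hle' : 100 * (z + (INR j + 1) * v) <= 151 * (u + v)) by nra.
  destruct j as [|[|j]].
  - left. unfold stepA, tame. simpl INR in *.
    replace (z + (0 + 1) * v) with (z + v) in * by ring. replace (z + 0 * v) with z in * by ring.
    repeat split; lra || easy.
  - right. unfold stepB, tame. simpl INR in *.
    replace (z + (1 + 1) * v) with (z + 2 * v) in * by ring. replace (z + 1 * v) with (z + v) in * by ring.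
    repeat split; lra || easy.
  - exfalso. rewrite !S_INR in Hle'. pose proof (pos_INR j). nra.
Qed.

Lemma tame_exists St x z u v : x < 151 / 100 -> orbit_closed St x -> St z u v ->
  exists z' u' v', tame St z' u' v'.
Proof.
  intros Hx Ho HS.
  assert (G : forall z u v, St z u v -> exists z' u' v', St z' u' v' /\ v' < z' /\
    100 * z' <= 151 * u' /\ (v < z -> z' <= 2 * v')).
  { clear z u v HS. intros z u v HS.
    pose proof (orbit_bounds _ _ _ _ _ Hx Ho HS) as (Hz & Hu & Hv & Hzu & Hc).
    destruct (proj2 Ho _ _ _ HS) as (j & HS' & Hlt & Hle). pose proof (pos_INR j).
    do 3 eexists. split; [exact HS'|]. split; [lra|]. split; [nra|]. intros. nra. }
  destruct (G _ _ _ HS) as (z1 & u1 & v1 & HS1 & H1 & H2 & _).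
  destruct (G _ _ _ HS1) as (z2 & u2 & v2 & HS2 & H3 & H4 & H5).
  exists z2, u2, v2. split; [easy|]. split; [easy|]. split; [auto | easy].
Qed.

Ltac bounds Hx Ho :=
  repeat match goal with
  | H : stepA _ _ _ _ |- _ => unfold stepA in H
  | H : stepB _ _ _ _ |- _ => unfold stepB in H
  end;
  repeat match goal with
  | H : tame ?St ?z ?u ?v |- _ =>
      let HS := fresh in destruct H as (HS & ? & ? & ?);
      pose proof (orbit_bounds _ _ _ _ _ Hx Ho HS) as (? & ? & ? & ? & ?); clear HS
  end.

Lemma not_BB St x z u v : x < 151 / 100 -> orbit_closed St x -> tame St z u v ->
  stepB (tame St) z u v -> ~ stepB (stepB (tame St)) z u v.
Proof. intros Hx Ho H0 H1 H2. bounds Hx Ho. lra. Qed.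

Lemma not_AAA St x z u v : x < 151 / 100 -> orbit_closed St x -> tame St z u v ->
  ~ stepA (stepA (stepA (tame St))) z u v.
Proof. intros Hx Ho H0 H1. bounds Hx Ho. lra. Qed.

Lemma not_ABAB St x z u v : x < 151 / 100 -> orbit_closed St x -> tame St z u v ->
  ~ stepA (stepB (stepA (stepB (tame St)))) z u v.
Proof. intros Hx Ho H0 H1. bounds Hx Ho. lra. Qed.

Lemma not_AABAB St x z u v : x < 151 / 100 -> orbit_closed St x -> tame St z u v ->
  stepA (stepA (tame St)) z u v -> ~ stepA (stepA (stepB (stepA (stepB (tame St))))) z u v.
Proof. intros Hx Ho H H0 H1. bounds Hx Ho. lra. Qed.

(** A state just after a step B is not followed by B. If it is followed by AB, the state reached is
    followed neither by B nor, ABAB being excluded, by AB once more. *)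
Lemma tight_exists St x z u v : x < 151 / 100 -> orbit_closed St x -> St z u v ->
  exists z' u' v', tight St z' u' v'.
Proof.
  intros Hx Ho HS.
  assert (G : forall z u v, tame St z u v -> exists z' u' v', tame St z' u' v' /\
    ~ stepB (tame St) z' u' v' /\ (stepA (stepB (tame St)) z' u' v' -> exists z u v, tight St z u v)).
  { clear z u v HS. 
    assert (GB : forall z u v, tame St z u v -> stepB (tame St) z u v -> exists z' u' v', tame St z' u' v' /\
      ~ stepB (tame St) z' u' v' /\ (stepA (stepB (tame St)) z' u' v' -> exists z u v, tight St z u v)).
    { intros z u v HT HB. exists (z + 2 * v), (u + v), (z + v).
      pose proof (not_BB _ _ _ _ _ Hx Ho HT HB) as HBB.
      split; [exact HB|]. split; [exact HBB|]. intros HAB.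
      exists (z + 2 * v + (z + v) + 2 * (z + 2 * v)), (u + v + (z + v) + (z + 2 * v)),
        (z + 2 * v + (z + v) + (z + 2 * v)).
      split; [exact HAB|]. split.
      - destruct (tame_step _ _ _ _ _ Hx Ho HB) as [HA|]; [|easy].
        exact (not_BB _ _ _ _ _ Hx Ho HA HAB).
      - exact (not_ABAB _ _ _ _ _ Hx Ho HB). }
    intros z u v HT.
    destruct (tame_step _ _ _ _ _ Hx Ho HT) as [HA|HB]; [|eauto].
    destruct (tame_step _ _ _ _ _ Hx Ho HA) as [HAA|HB]; [|eauto].
    destruct (tame_step _ _ _ _ _ Hx Ho HAA) as [HAAA|HB]; [|eauto].
    exfalso. exact (not_AAA _ _ _ _ _ Hx Ho HT HAAA). }
  destruct (tame_exists _ _ _ _ _ Hx Ho HS) as (z0 & u0 & v0 & HT).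
  destruct (G _ _ _ HT) as (z1 & u1 & v1 & HT1 & H1 & H2).
  destruct (classic (stepA (stepB (tame St)) z1 u1 v1)) as [H|H]; [auto|].
  exists z1, u1, v1. now split.
Qed.

Lemma tight_AA St x z u v : x < 151 / 100 -> orbit_closed St x -> tight St z u v ->
  stepA (stepA (tame St)) z u v.
Proof.
  intros Hx Ho (HT & H1 & H2).
  destruct (tame_step _ _ _ _ _ Hx Ho HT) as [HA|]; [|easy].
  now destruct (tame_step _ _ _ _ _ Hx Ho HA) as [HAA|].
Qed.

Lemma tight_step St x z u v : x < 151 / 100 -> orbit_closed St x -> tight St z u v ->
  tight St (4 * z + 3 * v) (u + 2 * v + 2 * z) (3 * z + 2 * v).
Proof.
  intros Hx Ho HH. pose proof (tight_AA _ _ _ _ _ Hx Ho HH) as HAA. destruct HH as (HT & _).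
  destruct (tame_step _ _ _ _ _ Hx Ho HAA) as [H|HB].
  { exfalso. exact (not_AAA _ _ _ _ _ Hx Ho HT H). }
  replace (4 * z + 3 * v) with (z + v + z + 2 * (z + v)) by ring.
  replace (u + 2 * v + 2 * z) with (u + v + z + (z + v)) by ring.
  replace (3 * z + 2 * v) with (z + v + z + (z + v)) by ring.
  split; [exact HB|]. split.
  - exact (not_BB _ _ _ _ _ Hx Ho HAA HB).
  - exact (not_AABAB _ _ _ _ _ Hx Ho HT HAA).
Qed.

(* On the blocks AAB, the form 3 u - 2 z is invariant and v - c z is multiplied by 3 - sqrt 10 for
   c = (sqrt 10 - 1) / 3, so the orbit approaches the direction (z, u, v) = (1, 2/3, c), on which
   the ratio (u + v) / z equals bound_const - 1 after the two steps A. *)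
Lemma no_orbit St x z u v : x < bound_const - 1 -> orbit_closed St x -> ~ St z u v.
Proof.
  intros Hx Ho HS. assert (Hx' : x < 151 / 100) by (pose proof bound_const_lt; lra).
  destruct (tight_exists _ _ _ _ _ Hx' Ho HS) as (z0 & u0 & v0 & H0). clear z u v HS.
  remember (sqrt 10) as r eqn:Er.
  assert (Hr : r * r = 10) by (subst r; apply sqrt_sqrt; lra).
  assert (Hr3 : 3 < r < 4) by (assert (0 <= r) by (subst r; apply sqrt_pos); nra).
  set (c := (r - 1) / 3).
  assert (Hz0 : 0 < z0).
  { destruct H0 as ((HS & _) & _). now apply (orbit_bounds _ _ _ _ _ Hx' Ho) in HS. }
  (* Linear growth of z is enough, since both error terms stay bounded. *)
  assert (G : forall k, exists z u v, tight St z u v /\ 3 * u - 2 * z = 3 * u0 - 2 * z0 /\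
    Rabs (v - c * z) <= Rabs (v0 - c * z0) /\ z0 * (INR k + 1) <= z).
  { induction k as [|k (z & u & v & HH & Ha & Hb & Hk)].
    - exists z0, u0, v0. split; [easy|]. split; [easy|]. split; [lra|]. simpl; lra.
    - pose proof (tight_step _ _ _ _ _ Hx' Ho HH) as HH'.
      exists (4 * z + 3 * v), (u + 2 * v + 2 * z), (3 * z + 2 * v).
      split; [easy|]. split; [lra|]. split.
      + replace (3 * z + 2 * v - c * (4 * z + 3 * v)) with ((3 - r) * (v - c * z)).
        * rewrite Rabs_mult. apply Rle_trans with (1 * Rabs (v - c * z)); [|lra].
          apply Rmult_le_compat_r; [apply Rabs_pos|]. apply Rabs_le. lra.
        * apply Rminus_diag_uniq_sym.
          replace (_ - _) with ((10 - r * r) * z / 3) by (unfold c; field). rewrite Hr. field.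
      + rewrite S_INR. destruct HH as ((HS & _) & _).
        apply (orbit_bounds _ _ _ _ _ Hx' Ho) in HS as (_ & _ & Hv & _).
        pose proof (pos_INR k). nra. }
  set (e := bound_const - 1 - x).
  set (M := Rabs (3 * u0 - 2 * z0) + Rabs (v0 - c * z0)).
  assert (HM : 0 < 2 * e * z0) by (unfold e; nra).
  destruct (INR_unbounded (M / (2 * e * z0))) as [k Hk].
  destruct (G k) as (z & u & v & HH & Ha & Hb & Hzk).
  pose proof (tight_AA _ _ _ _ _ Hx' Ho HH) as (HS & _).
  apply (proj1 Ho) in HS as (_ & _ & _ & _ & HS).
  destruct HH as ((HS' & _) & _).
  apply (orbit_bounds _ _ _ _ _ Hx' Ho) in HS' as (Hz & Hu & Hv & _).
  (* After two steps A the triple is (2 z + v, u + v + z, z + v). The excess over the critical ratio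
     combines only the invariant and the error, hence is bounded, whereas x below the critical ratio
     by e would force a deficit of e (2 z + v). *)
  assert (Hid : u + v + z + (z + v) - (bound_const - 1) * (z + v + z) =
    (3 * u - 2 * z) / 3 + (2 - (bound_const - 1)) * (v - c * z)).
  { apply Rminus_diag_uniq. unfold bound_const. rewrite <- Er.
    replace (_ - _) with ((10 - r * r) * z * 4 / 45) by (unfold c; field). rewrite Hr. field. }
  assert (Hlin : (x - (bound_const - 1)) * (2 * z + v) >= (3 * u - 2 * z) / 3 + (2 - (bound_const - 1)) * (v - c * z)) by nra.
  assert (Hbd : - Rabs (v0 - c * z0) <= (2 - (bound_const - 1)) * (v - c * z)).
  { assert (0 < 2 - (bound_const - 1) <= 1) by (unfold bound_const; rewrite <- Er; lra).
    pose proof (Rabs_pos (v - c * z)). pose proof (Rle_abs (- (v - c * z))) as Hq. rewrite Rabs_Ropp in Hq. nra. }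
  rewrite Ha in Hlin. pose proof (Rle_abs (- (3 * u0 - 2 * z0))) as Hq. rewrite Rabs_Ropp in Hq.
  pose proof (Rabs_pos (3 * u0 - 2 * z0)).
  assert (He : 0 < e) by (unfold e; lra).
  assert (He3 : e * (2 * z + v) <= M) by (unfold e, M; lra).
  apply (Rmult_lt_compat_r (2 * e * z0)) in Hk; [|easy].
  replace (M / (2 * e * z0) * (2 * e * z0)) with M in Hk by (field; lra).
  assert (0 <= e * v) by nra. assert (e * (z0 * (INR k + 1)) <= e * z) by nra. lra.
Qed.

(** * Expansions in base b *)

Definition digits_lt (b : nat) (t : nat -> nat) : Prop := forall j, (t j < b)%nat.

Definition val (b : nat) (t : nat -> nat) : R := Series (fun j => INR (t j) / INR b ^ S j).

Fixpoint digit_sum (b : nat) (t : nat -> nat) (n : nat) : Z :=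
  match n with
  | O => 0%Z
  | S m => (Z.of_nat b * digit_sum b t m + Z.of_nat (t m))%Z
  end.

Lemma digit_bound b t j : digits_lt b t -> 0 <= INR (t j) <= INR b - 1.
Proof.
  intros H. split; [apply pos_INR|]. specialize (H j).
  change 1 with (INR 1). rewrite <- minus_INR by lia. apply le_INR. lia.
Qed.

Lemma is_series_max_digits b : (2 <= b)%nat ->
  is_series (fun j => (INR b - 1) / INR b ^ S j) 1.
Proof.
  intros Hb. apply le_INR in Hb. simpl in Hb.
  apply is_series_ext with (fun j => (INR b - 1) / INR b * (/ INR b) ^ j).
  - intros j. rewrite pow_inv. simpl. field. split; [apply pow_nonzero|]; lra.
  - assert (H : is_series (fun j => (INR b - 1) / INR b * (/ INR b) ^ j)
      ((INR b - 1) / INR b * / (1 - / INR b))).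
    { apply (is_series_scal_l ((INR b - 1) / INR b) (fun j => (/ INR b) ^ j)).
      apply is_series_geom. rewrite Rabs_pos_eq.
      - apply (Rmult_lt_reg_l (INR b)); [lra|]. rewrite Rinv_r by lra. lra.
      - left. apply Rinv_0_lt_compat. lra. }
    replace ((INR b - 1) / INR b * / (1 - / INR b)) with 1 in H; [exact H | field; lra].
Qed.

Lemma term_bound b t j : (2 <= b)%nat -> digits_lt b t ->
  0 <= INR (t j) / INR b ^ S j <= (INR b - 1) / INR b ^ S j.
Proof.
  intros Hb Ht. apply le_INR in Hb. simpl in Hb.
  assert (0 < INR b ^ S j) by (apply pow_lt; lra).
  pose proof (digit_bound _ _ j Ht). split.
  - apply Rdiv_le_0_compat; lra.
  - apply Rmult_le_compat_r; [left; now apply Rinv_0_lt_compat | lra].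
Qed.

Lemma ex_series_val b t : (2 <= b)%nat -> digits_lt b t ->
  ex_series (fun j => INR (t j) / INR b ^ S j).
Proof.
  intros Hb Ht. apply (ex_series_le (V := R_CompleteNormedModule) _ (fun j => (INR b - 1) / INR b ^ S j)).
  - intros j. pose proof (term_bound b t j Hb Ht). unfold norm; simpl.
    unfold abs; simpl. rewrite Rabs_pos_eq; [apply H | apply H].
  - eexists. now apply is_series_max_digits.
Qed.

Lemma val_bounds b t : (2 <= b)%nat -> digits_lt b t -> 0 <= val b t <= 1.
Proof.
  intros Hb Ht. unfold val. split.
  - rewrite <- (Rmult_0_l (Series (fun j => INR (t j) / INR b ^ S j))).
    rewrite <- Series_scal_l. apply Series_le; [|now apply ex_series_val].
    intros j. pose proof (term_bound b t j Hb Ht). lra.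
  - rewrite <- (is_series_unique _ _ (is_series_max_digits b Hb)).
    apply Series_le; [|eexists; now apply is_series_max_digits].
    intros j. now apply term_bound.
Qed.

Lemma val_step b t : (2 <= b)%nat -> digits_lt b t ->
  INR b * val b t = INR (t O) + val b (tail 1 t).
Proof.
  intros Hb Ht. unfold val at 1. rewrite Series_incr_1 by now apply ex_series_val.
  assert (Hb' : 2 <= INR b) by (apply le_INR in Hb; simpl in Hb; lra).
  rewrite Rmult_plus_distr_l. f_equal.
  - simpl. field. lra.
  - rewrite <- Series_scal_l. apply Series_ext. intros j. unfold tail. simpl.
    field. split; [apply pow_nonzero|]; lra.
Qed.

Lemma digits_lt_tail b t m : digits_lt b t -> digits_lt b (tail m t).
Proof. intros H j. apply H. Qed.

Lemma tail_tail m n t : forall j, tail m (tail n t) j = tail (n + m) t j.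
Proof. intros j. unfold tail. f_equal. lia. Qed.

Lemma val_ext b t t' : (forall j, t j = t' j) -> val b t = val b t'.
Proof. intros H. apply Series_ext. intros j. now rewrite H. Qed.

Lemma val_shift b t n : (2 <= b)%nat -> digits_lt b t ->
  INR b ^ n * val b t = IZR (digit_sum b t n) + val b (tail n t).
Proof.
  intros Hb Ht. induction n as [|n IH]; simpl.
  - rewrite Rmult_1_l, Rplus_0_l. now apply val_ext.
  - rewrite Rmult_assoc, IH, Rmult_plus_distr_l, val_step by (auto; now apply digits_lt_tail).
    rewrite plus_IZR, mult_IZR, <- !INR_IZR_INZ.
    unfold tail at 1. rewrite Nat.add_0_r.
    rewrite (val_ext b (tail 1 (tail n t)) (tail (S n) t)); [ring|].
    intros j. rewrite tail_tail. now rewrite Nat.add_1_r.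
Qed.

Lemma digit_sum_ext b t t' n : (forall k, (k < n)%nat -> t k = t' k) ->
  digit_sum b t n = digit_sum b t' n.
Proof.
  induction n as [|n IH]; intros H; [easy|]. simpl. rewrite IH, H by (auto; lia). easy.
Qed.

Lemma val_close b t t' n : (2 <= b)%nat -> digits_lt b t -> digits_lt b t' ->
  (forall k, (k < n)%nat -> t k = t' k) -> Rabs (val b t - val b t') <= / INR b ^ n.
Proof.
  intros Hb Ht Ht' E.
  assert (Hb' : 2 <= INR b) by (apply le_INR in Hb; simpl in Hb; lra).
  assert (Hp : 0 < INR b ^ n) by (apply pow_lt; lra).
  apply (Rmult_le_reg_l (INR b ^ n)); [easy|]. rewrite Rinv_r by lra.
  rewrite <- (Rabs_pos_eq (INR b ^ n)) at 1 by lra. rewrite <- Rabs_mult, Rmult_minus_distr_l.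
  rewrite !val_shift by easy. rewrite (digit_sum_ext b t t' n E).
  pose proof (val_bounds b _ Hb (digits_lt_tail _ _ n Ht)).
  pose proof (val_bounds b _ Hb (digits_lt_tail _ _ n Ht')). apply Rabs_le. lra.
Qed.

Lemma shift_diff b t u w : (2 <= b)%nat -> digits_lt b t ->
  (INR b ^ w - INR b ^ u) * val b t - IZR (digit_sum b t w - digit_sum b t u) =
  val b (tail w t) - val b (tail u t).
Proof. intros Hb Ht. rewrite Rmult_minus_distr_r, !val_shift, minus_IZR by easy. ring. Qed.

Lemma repetition_approx b t u w n : (2 <= b)%nat -> digits_lt b t -> fac t n u = fac t n w ->
  Rabs ((INR b ^ w - INR b ^ u) * val b t - IZR (digit_sum b t w - digit_sum b t u)) <= / INR b ^ n.
Proof.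
  intros Hb Ht E.
  rewrite shift_diff by easy. apply val_close; try easy; try now apply digits_lt_tail.
  intros k Hk. symmetry. now apply (proj1 (fac_eq t n u w) E).
Qed.

Lemma val_one b t : (2 <= b)%nat -> digits_lt b t -> val b t = 1 -> forall j, t j = (b - 1)%nat.
Proof.
  intros Hb Ht E j. revert t Ht E. induction j as [|j IH]; intros t Ht E.
  - pose proof (val_step b t Hb Ht) as H. rewrite E in H.
    pose proof (val_bounds b _ Hb (digits_lt_tail _ _ 1 Ht)). pose proof (digit_bound b t 0 Ht).
    apply INR_eq. rewrite minus_INR by lia. simpl. lra.
  - pose proof (val_step b t Hb Ht) as H. rewrite E in H.
    pose proof (val_bounds b _ Hb (digits_lt_tail _ _ 1 Ht)). pose proof (digit_bound b t 0 Ht).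
    apply (IH (tail 1 t)); [now apply digits_lt_tail | lra].
Qed.

(** Double expansions arise from tails of digits b - 1, whose value is 1; the strict bounds exclude
    them. *)
Lemma val_inj b t t' : (2 <= b)%nat -> digits_lt b t -> digits_lt b t' ->
  (forall m, val b (tail m t) < 1) -> (forall m, val b (tail m t') < 1) ->
  val b t = val b t' -> forall j, t j = t' j.
Proof.
  intros Hb Ht Ht' H1 H1' E j. revert t t' Ht Ht' H1 H1' E.
  assert (G : forall t t', digits_lt b t -> digits_lt b t' ->
    (forall m, val b (tail m t) < 1) -> (forall m, val b (tail m t') < 1) ->
    val b t = val b t' -> t O = t' O /\ val b (tail 1 t) = val b (tail 1 t')).
  { intros t t' Ht Ht' H1 H1' E.
    pose proof (val_step b t Hb Ht) as H. pose proof (val_step b t' Hb Ht') as H'.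
    pose proof (val_bounds b _ Hb (digits_lt_tail _ _ 1 Ht)).
    pose proof (val_bounds b _ Hb (digits_lt_tail _ _ 1 Ht')).
    specialize (H1 1%nat). specialize (H1' 1%nat). rewrite E in H.
    assert (E0 : t O = t' O); [|split; [easy | rewrite E0 in H; lra]].
    destruct (lt_eq_lt_dec (t O) (t' O)) as [[Hl|]|Hl]; [exfalso | easy | exfalso];
      apply Nat.le_succ_l, le_INR in Hl; rewrite S_INR in Hl; lra. }
  induction j as [|j IH]; intros t t' Ht Ht' H1 H1' E; destruct (G t t') as [G1 G2]; auto.
  apply (IH (tail 1 t) (tail 1 t')); try now apply digits_lt_tail; try easy.
  - intros m. rewrite (val_ext _ _ _ (tail_tail m 1 t)). apply H1.
  - intros m. rewrite (val_ext _ _ _ (tail_tail m 1 t')). apply H1'.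
  - exact G2.
Qed.

(** For a rational value, q times the value of every tail is an integer in [0, q]; two tails then
    have equal value and coincide. *)
Lemma val_irrational b t (p q : Z) : (2 <= b)%nat -> digits_lt b t -> ~ eventually_periodic t ->
  (0 < q)%Z -> IZR q * val b t <> IZR p.
Proof.
  intros Hb Ht Hap Hq E.
  assert (H1 : forall m, val b (tail m t) < 1).
  { intros m. destruct (val_bounds b _ Hb (digits_lt_tail _ _ m Ht)) as [_ [H|H]]; [easy|].
    exfalso. apply Hap. exists m, 1%nat. split; [lia|]. intros i Hi.
    pose proof (val_one b _ Hb (digits_lt_tail _ _ m Ht) H) as D. unfold tail in D.
    pose proof (D (i - m)%nat) as D1. pose proof (D (i - m + 1)%nat) as D2.
    replace (m + (i - m))%nat with i in D1 by lia.
    replace (m + (i - m + 1))%nat with (i + 1)%nat in D2 by lia. congruence. }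
  assert (HZ : forall m, exists z : Z, IZR q * val b (tail m t) = IZR z /\ (0 <= z <= q)%Z).
  { intros m. exists (Z.of_nat b ^ Z.of_nat m * p - q * digit_sum b t m)%Z.
    assert (Ez : IZR q * val b (tail m t) = IZR (Z.of_nat b ^ Z.of_nat m * p - q * digit_sum b t m)).
    { rewrite minus_IZR, !mult_IZR, <- E, <- pow_IZR, <- INR_IZR_INZ.
      pose proof (val_shift b t m Hb Ht). nra. }
    split; [easy|]. pose proof (val_bounds b _ Hb (digits_lt_tail _ _ m Ht)).
    apply IZR_lt in Hq. split; apply le_IZR; rewrite <- Ez; nra. }
  set (l := map (fun k => Z.of_nat k) (seq 0 (S (Z.to_nat q)))).
  assert (Hpig : exists i j, (i < j)%nat /\ val b (tail i t) = val b (tail j t)).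
  { apply NNPP. intros Hno.
    assert (G : forall n, exists l' : list Z, NoDup l' /\ length l' = n /\ incl l' l /\
      forall z, In z l' -> exists m, (m < n)%nat /\ IZR q * val b (tail m t) = IZR z).
    { induction n as [|n (l' & H2 & H3 & H4 & H5)].
      - exists []. repeat split; [constructor | easy | easy].
      - destruct (HZ n) as (z & Hz & Hzq). exists (z :: l'). repeat split.
        + constructor; [|easy]. intros Hin. destruct (H5 z Hin) as (m & Hm & Em).
          apply Hno. exists m, n. split; [easy|]. apply (Rmult_eq_reg_l (IZR q)); [congruence|].
          apply IZR_lt in Hq. lra.
        + simpl. now rewrite H3.
        + intros y [<-|Hy]; [|auto]. apply in_map_iff. exists (Z.to_nat z).
          split; [lia|]. apply in_seq. lia.
        + intros y [<-|Hy]; [exists n; split; [lia | easy]|].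
          destruct (H5 y Hy) as (m & Hm & Em). exists m. split; [lia | easy]. }
    destruct (G (S (length l))) as (l' & H2 & H3 & H4 & _).
    apply NoDup_incl_length in H4; [|easy]. lia. }
  destruct Hpig as (i & j & Hij & Ev). apply Hap. exists i, (j - i)%nat. split; [lia|].
  intros k Hk.
  pose proof (val_inj b (tail i t) (tail j t) Hb (digits_lt_tail _ _ i Ht) (digits_lt_tail _ _ j Ht)) as D.
  specialize (D (fun m => eq_ind_r (fun x => x < 1) (H1 (i + m)%nat) (val_ext b _ _ (tail_tail m i t)))).
  specialize (D (fun m => eq_ind_r (fun x => x < 1) (H1 (j + m)%nat) (val_ext b _ _ (tail_tail m j t)))).
  specialize (D Ev (k - i)%nat). unfold tail in D.
  replace (i + (k - i))%nat with k in D by lia.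
  replace (j + (k - i))%nat with (k + (j - i))%nat in D by lia. now symmetry.
Qed.

(** * Irrationality exponents *)

Lemma reduced_fraction (p q : Z) : (0 < q)%Z -> exists p' q' : Z,
  (0 < q' <= q)%Z /\ Z.gcd p' q' = 1%Z /\ IZR p / IZR q = IZR p' / IZR q'.
Proof.
  intros Hq. assert (Hg0 : Z.gcd p q <> 0%Z) by (intros E; apply Z.gcd_eq_0_r in E; lia).
  pose proof (Z.gcd_nonneg p q) as Hg.
  destruct (Z.gcd_divide_l p q) as [p' Hp'], (Z.gcd_divide_r p q) as [q' Hq'].
  pose proof (Z.gcd_div_gcd p q _ Hg0 eq_refl) as H.
  remember (Z.gcd p q) as g eqn:Eg. clear Eg.
  exists p', q'. subst p q. rewrite !Z.div_mul in H by easy.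
  split; [nia|]. split; [easy|]. rewrite !mult_IZR. field.
  split; apply not_0_IZR; nia.
Qed.

Lemma exp_le a c : a <= c -> exp a <= exp c.
Proof. intros [H| ->]; [left; now apply exp_increasing | right; easy]. Qed.

Lemma Rpower_le_neg q1 q2 m : 0 < q1 -> q1 <= q2 -> 0 <= m -> Rpower q2 (- m) <= Rpower q1 (- m).
Proof.
  intros H1 H2 Hm. unfold Rpower. apply exp_le.
  assert (ln q1 <= ln q2) by now apply ln_le. nra.
Qed.

Lemma approx_gap xi (l : list (Z * Z)) : exists d, 0 < d /\ forall p q, In (p, q) l ->
  xi <> IZR p / IZR q -> d <= Rabs (xi - IZR p / IZR q).
Proof.
  induction l as [|[p0 q0] l (d & Hd & H)].
  - exists 1. split; [lra | easy].
  - destruct (Req_dec xi (IZR p0 / IZR q0)) as [E|E].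
    + exists d. split; [easy|]. intros p q [Hpq|Hin] Hne; [|auto].
      injection Hpq as -> ->. easy.
    + assert (Hp : 0 < Rabs (xi - IZR p0 / IZR q0)) by (apply Rabs_pos_lt; lra).
      exists (Rmin d (Rabs (xi - IZR p0 / IZR q0))). split; [now apply Rmin_glb_lt|].
      intros p q [Hpq|Hin] Hne.
      * injection Hpq as <- <-. apply Rmin_r.
      * apply Rle_trans with d; [apply Rmin_l | auto].
Qed.

Lemma ex_large (a c M : R) : 0 < a -> exists N, forall n, N <= n -> c < a * n /\ M <= n.
Proof.
  intros Ha. exists (Rmax M (c / a + 1)). intros n Hn.
  pose proof (Rmax_l M (c / a + 1)). pose proof (Rmax_r M (c / a + 1)). split; [|lra].
  replace c with (a * (c / a)) by (field; lra). apply Rmult_lt_compat_l; lra.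
Qed.

(** The given fractions need not be reduced or distinct. Reduction only lowers the denominator, and
    a finite list of solutions keeps a positive distance from xi, which the given fractions
    eventually undercut. *)
Lemma infinitely_many_sols_intro xi B x C mu : 1 < B -> 0 < x -> 0 < C -> 1 <= mu < 1 + x ->
  (forall N, exists (p q : Z) (w n : R), (0 < q)%Z /\ IZR q <= Rpower B w /\ N <= n /\ x * w <= n /\
     0 < Rabs (IZR q * xi - IZR p) <= C * Rpower B (- n)) ->
  infinitely_many_sols xi mu.
Proof.
  intros HB Hx HC Hmu H [l Hl].
  destruct (approx_gap xi l) as (d & Hd & Hgap).
  assert (HlB : 0 < ln B) by (rewrite <- ln_1; apply ln_increasing; lra).
  (* [N1] makes the fraction a solution for mu, [N2] brings it closer to xi than d. *)
  destruct (ex_large ((1 - (mu - 1) / x) * ln B) (ln C) 0) as [N1 HN1].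
  { apply Rmult_lt_0_compat; [|easy]. apply (Rmult_lt_reg_r x); [easy|].
    replace ((1 - (mu - 1) / x) * x) with (1 + x - mu) by (field; lra). lra. }
  destruct (ex_large (ln B) (ln C - ln d) 0) as [N2 HN2]; [easy|].
  destruct (H (Rmax N1 N2)) as (p & q & w & n & Hq & Hqw & Hn & Hwn & Hpos & Hle).
  destruct (HN1 n) as [Hn1 Hn0]; [pose proof (Rmax_l N1 N2); lra|].
  destruct (HN2 n) as [Hn2 _]; [pose proof (Rmax_r N1 N2); lra|]. clear HN1 HN2.
  destruct (reduced_fraction p q Hq) as (p' & q' & Hq' & Hgcd & E).
  assert (Hq1 : 1 <= IZR q) by (apply IZR_le; lia).
  assert (Hq1' : 1 <= IZR q' <= IZR q) by (split; apply IZR_le; lia).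
  assert (Hdist : Rabs (xi - IZR p / IZR q) = Rabs (IZR q * xi - IZR p) / IZR q).
  { replace (xi - IZR p / IZR q) with ((IZR q * xi - IZR p) / IZR q) by (field; lra).
    unfold Rdiv. rewrite Rabs_mult, (Rabs_pos_eq (/ IZR q)); [easy|]. left. apply Rinv_0_lt_compat. lra. }
  assert (HCB : C * Rpower B (- n) = exp (ln C - n * ln B)).
  { unfold Rpower, Rminus. rewrite exp_plus, exp_ln by easy. do 2 f_equal. ring. }
  assert (Hdist_pos : 0 < Rabs (xi - IZR p / IZR q)).
  { rewrite Hdist. apply Rdiv_lt_0_compat; lra. }
  assert (Hin : In (p', q') l).
  { apply Hl. simpl. split; [lia|]. split; [easy|]. rewrite <- E, Hdist.
    apply Rlt_le_trans with (Rpower (IZR q) (- mu)); [|apply Rpower_le_neg; lra].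
    apply (Rmult_lt_reg_r (IZR q)); [lra|]. unfold Rdiv. rewrite Rmult_assoc, Rinv_l, Rmult_1_r by lra.
    apply Rle_lt_trans with (1 := Hle). rewrite HCB.
    replace (Rpower (IZR q) (- mu) * IZR q) with (exp ((1 - mu) * ln (IZR q))).
    2:{ unfold Rpower. rewrite <- (exp_ln (IZR q)) at 3 by lra. rewrite <- exp_plus. f_equal. ring. }
    apply exp_increasing.
    assert (Hlq : ln (IZR q) <= w * ln B).
    { rewrite <- (ln_exp (w * ln B)). apply ln_le; [lra | exact Hqw]. }
    assert (Hw : w <= n / x).
    { apply (Rmult_le_reg_l x); [easy|]. replace (x * (n / x)) with n by (field; lra). easy. }
    assert ((mu - 1) * ln (IZR q) <= (mu - 1) * (w * ln B)) by (apply Rmult_le_compat_l; lra).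
    assert ((mu - 1) * (w * ln B) <= (mu - 1) * (n / x * ln B)).
    { apply Rmult_le_compat_l; [lra|]. apply Rmult_le_compat_r; lra. }
    replace ((mu - 1) * (n / x * ln B)) with ((mu - 1) / x * ln B * n) in * by (field; lra). lra. }
  assert (Hd1 : d <= Rabs (xi - IZR p / IZR q)).
  { rewrite E. apply Hgap; [easy|]. intros E'. rewrite <- E in E'. rewrite <- E', Rminus_diag, Rabs_R0 in Hdist_pos. lra. }
  assert (Hd2 : Rabs (xi - IZR p / IZR q) < d).
  { rewrite Hdist. apply Rle_lt_trans with (Rabs (IZR q * xi - IZR p)).
    - apply (Rmult_le_reg_r (IZR q)); [lra|]. unfold Rdiv. rewrite Rmult_assoc, Rinv_l by lra.
      apply Rmult_le_compat_l; lra.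
    - apply Rle_lt_trans with (1 := Hle). rewrite HCB, <- (exp_ln d) by easy. apply exp_increasing. lra. }
  lra.
Qed.

Lemma irr_exponent_ge xi B x C : 1 < B -> 0 < x -> 0 < C ->
  (forall N, exists (p q : Z) (w n : R), (0 < q)%Z /\ IZR q <= Rpower B w /\ N <= n /\ x * w <= n /\
     0 < Rabs (IZR q * xi - IZR p) <= C * Rpower B (- n)) ->
  Rbar_le (1 + x) (irr_exponent xi).
Proof.
  intros HB Hx HC H. unfold irr_exponent.
  destruct (Lub_Rbar_correct (fun mu => infinitely_many_sols xi mu)) as [Hub _].
  destruct (Rbar_le_lt_dec (1 + x) (Lub_Rbar (fun mu => infinitely_many_sols xi mu))) as [|Hlt]; [easy|].
  exfalso. assert (G : forall mu, 1 <= mu < 1 + x -> Rbar_le mu (Lub_Rbar (fun mu => infinitely_many_sols xi mu))).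
  { intros mu Hmu. apply Hub. now apply infinitely_many_sols_intro with B x C. }
  destruct (Lub_Rbar (fun mu => infinitely_many_sols xi mu)) as [r| |]; simpl in *; try easy.
  - specialize (G (Rmax 1 ((r + (1 + x)) / 2))). simpl in G.
    pose proof (Rmax_l 1 ((r + (1 + x)) / 2)). pose proof (Rmax_r 1 ((r + (1 + x)) / 2)).
    assert (Rmax 1 ((r + (1 + x)) / 2) < 1 + x) by (apply Rmax_lub_lt; lra). lra.
  - apply (G 1). lra.
Qed.

Lemma bounded_sols_finite xi mu (N : Z) : 0 <= mu ->
  exists l, forall p q, approx_sol xi mu (p, q) -> (q <= N)%Z -> In (p, q) l.
Proof.
  intros Hmu.
  destruct (archimed ((Rabs xi + 1) * (Rabs (IZR N) + 1))) as [HM _].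
  set (M := up ((Rabs xi + 1) * (Rabs (IZR N) + 1))) in *.
  set (rg := map (fun k => Z.of_nat k - M)%Z (seq 0 (S (Z.to_nat (2 * M))))).
  exists (list_prod rg rg). intros p q (Hq & _ & Ha) HqN.
  assert (Hq1 : 1 <= IZR q) by (apply IZR_le; lia).
  assert (Hpq : Rabs (IZR p) <= (Rabs xi + 1) * IZR q).
  { assert (Ha' : Rabs (xi - IZR p / IZR q) < 1).
    { apply Rlt_le_trans with (1 := Ha). unfold Rpower. rewrite <- exp_0. apply exp_le.
      assert (0 <= ln (IZR q)) by (rewrite <- ln_1; apply ln_le; lra). nra. }
    replace (IZR p) with ((IZR p / IZR q) * IZR q) by (field; lra).
    rewrite Rabs_mult, (Rabs_pos_eq (IZR q)) by lra. apply Rmult_le_compat_r; [lra|].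
    replace (IZR p / IZR q) with (xi + (- (xi - IZR p / IZR q))) by ring.
    apply Rle_trans with (1 := Rabs_triang _ _). rewrite Rabs_Ropp. lra. }
  assert (HN : IZR q <= Rabs (IZR N)) by (apply IZR_le in HqN; pose proof (Rle_abs (IZR N)); lra).
  pose proof (Rabs_pos xi).
  assert (HpM : Rabs (IZR p) < IZR M) by nra. assert (HqM : IZR q < IZR M) by nra.
  apply Rabs_def2 in HpM as [Hp1 Hp2].
  apply lt_IZR in Hp1, HqM. rewrite <- opp_IZR in Hp2. apply lt_IZR in Hp2.
  apply in_prod; unfold rg; apply in_map_iff.
  - exists (Z.to_nat (p + M)). split; [lia|]. apply in_seq. lia.
  - exists (Z.to_nat (q + M)). split; [lia|]. apply in_seq. lia.
Qed.

(** The reference fractions leave no gap on a logarithmic scale. For p/q, take the one whose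
    interval [w, w') contains the logarithm of 2 C q to base B: then q |q' xi - p'| <= 1/2. Either
    p/q equals p'/q', whose distance to xi is bounded below, or the two differ by at least 1/(q q'),
    which excludes exponents above 2 for large q. *)
Lemma irr_exponent_le xi B y C T0 : 1 < B -> 1 <= y -> 0 < C ->
  (forall T, T0 <= T -> exists (p q : Z) (w w' : R), (0 < q)%Z /\ w <= T < w' /\ w' <= y * w + C /\
     IZR q <= C * Rpower B w /\
     / C * Rpower B (- w') <= Rabs (IZR q * xi - IZR p) <= C * Rpower B (- w')) ->
  Rbar_le (irr_exponent xi) (1 + y).
Proof.
  intros HB Hy HC H. unfold irr_exponent.
  apply (Lub_Rbar_correct (fun mu => infinitely_many_sols xi mu)).
  intros mu Hinf. simpl. destruct (Rle_lt_dec mu (1 + y)) as [|Hmu]; [easy | exfalso].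
  assert (HlB : 0 < ln B) by (rewrite <- ln_1; apply ln_increasing; lra).
  set (L := ln C) in *.
  set (lD := ln 2 + L).
  (* [N1] serves the case of distinct fractions, [N2] that of equal ones, and [N3] puts T above
     [T0]. *)
  destruct (ex_large (mu - 2) (ln 4 + 2 * L) 0) as [N1 HN1]; [lra|].
  destruct (ex_large (mu - 1 - y) (2 * L + C * ln B + (1 + y) * lD) 0) as [N2 HN2]; [lra|].
  set (N3 := T0 * ln B - lD).
  set (N := Rmax (Rmax N1 N2) N3).
  destruct (bounded_sols_finite xi mu (up (exp N))) as [l Hl]; [lra|].
  apply Hinf. exists l. intros [p q] Hs. apply Hl; [easy|].
  destruct (Z_le_gt_dec q (up (exp N))) as [|HqN]; [easy | exfalso].
  destruct Hs as (Hq & _ & Ha).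
  assert (Hq1 : 1 <= IZR q) by (apply IZR_le; lia).
  assert (Hlq : N <= ln (IZR q)).
  { rewrite <- (ln_exp N). apply ln_le; [apply exp_pos|].
    destruct (archimed (exp N)) as [Hup _]. apply Z.gt_lt, IZR_lt in HqN. lra. }
  assert (HN : Rmax N1 N2 <= N) by apply Rmax_l. assert (HN3 : N3 <= N) by apply Rmax_r.
  pose proof (Rmax_l N1 N2). pose proof (Rmax_r N1 N2).
  destruct (HN1 (ln (IZR q))) as [Hn1 Hlq0]; [lra|].
  destruct (HN2 (ln (IZR q))) as [Hn2 _]; [lra|]. clear HN1 HN2.
  set (lq := ln (IZR q)) in *.
  assert (Eq : IZR q = exp lq) by (unfold lq; rewrite exp_ln; lra).
  assert (EC : C = exp L) by (unfold L; now rewrite exp_ln).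
  set (T := (lD + lq) / ln B).
  assert (HT : T * ln B = lD + lq) by (unfold T; field; lra).
  destruct (H T) as (p' & q' & w & w' & Hq' & Hw & Hww & Hqw & Hlo & Hhi).
  { apply (Rmult_le_reg_r (ln B)); [easy|]. rewrite HT. unfold N3 in *. lra. }
  assert (Hq1' : 1 <= IZR q') by (apply IZR_le; lia).
  assert (Ea : Rpower (IZR q) (- mu) = exp (- mu * lq)) by reflexivity.
  rewrite Ea in Ha. unfold Rpower in Hqw, Hlo, Hhi.
  assert (HwT : w * ln B <= lD + lq) by (rewrite <- HT; apply Rmult_le_compat_r; lra).
  assert (HwT' : lD + lq < w' * ln B) by (rewrite <- HT; apply Rmult_lt_compat_r; lra).
  assert (Hqw' : IZR q' <= exp (L + w * ln B)) by (rewrite exp_plus, <- EC; lra).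
  destruct (Z.eq_dec (q' * p) (p' * q)) as [E|E].
  - assert (Ef : IZR p / IZR q = IZR p' / IZR q').
    { apply (f_equal IZR) in E. rewrite !mult_IZR in E. apply (Rmult_eq_reg_r (IZR q * IZR q')); [|nra].
      field_simplify; [|lra|lra]. lra. }
    rewrite Ef in Ha.
    assert (Hdist : Rabs (xi - IZR p' / IZR q') * IZR q' = Rabs (IZR q' * xi - IZR p')).
    { rewrite <- (Rabs_pos_eq (IZR q')) at 2 by lra. rewrite <- Rabs_mult. f_equal. field. lra. }
    assert (Hx1 : exp (- L - w' * ln B) <= exp (- mu * lq + (L + w * ln B))).
    { replace (exp (- L - w' * ln B)) with (/ C * exp (- w' * ln B)).
      2:{ rewrite EC, <- exp_Ropp, <- exp_plus. f_equal. ring. }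
      apply Rle_trans with (1 := Hlo). rewrite <- Hdist, exp_plus.
      apply Rmult_le_compat; [apply Rabs_pos | lra | lra | easy]. }
    assert (Hx2 : - L - w' * ln B <= - mu * lq + (L + w * ln B)).
    { destruct (Rle_lt_dec (- L - w' * ln B) (- mu * lq + (L + w * ln B))) as [|Hlt]; [easy|].
      apply exp_increasing in Hlt. lra. }
    assert (Hx3 : w' * ln B <= y * (w * ln B) + C * ln B) by nra.
    assert (Hx4 : (1 + y) * (w * ln B) <= (1 + y) * (lD + lq)) by (apply Rmult_le_compat_l; lra).
    lra.
  - assert (Hk1 : 1 <= Rabs (IZR (q' * p - p' * q))).
    { rewrite <- abs_IZR. apply IZR_le. lia. }
    replace (IZR (q' * p - p' * q)) with
      (- (IZR q' * IZR q) * (xi - IZR p / IZR q) + IZR q * (IZR q' * xi - IZR p')) in Hk1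
      by (rewrite minus_IZR, !mult_IZR; field; lra).
    apply Rle_trans with (2 := Rabs_triang _ _) in Hk1. rewrite !Rabs_mult, Rabs_Ropp, Rabs_mult in Hk1.
    rewrite (Rabs_pos_eq (IZR q)), (Rabs_pos_eq (IZR q')) in Hk1 by lra.
    assert (Hk2 : IZR q * Rabs (IZR q' * xi - IZR p') <= / 2).
    { apply Rle_trans with (IZR q * (C * exp (- w' * ln B))); [apply Rmult_le_compat_l; lra|].
      rewrite Eq, EC, <- !exp_plus. rewrite <- (exp_ln (/ 2)), ln_Rinv by lra. apply exp_le.
      unfold lD in *. lra. }
    assert (Hk3 : IZR q' * IZR q * Rabs (xi - IZR p / IZR q) <= exp (L + w * ln B + lq + - mu * lq)).
    { rewrite !exp_plus, <- Eq, <- exp_plus. apply Rmult_le_compat; [nra | apply Rabs_pos | nra | lra]. }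
    assert (Hk4 : exp (- ln 2) <= exp (L + w * ln B + lq + - mu * lq)).
    { rewrite <- ln_Rinv, exp_ln by lra. lra. }
    assert (Hk5 : - ln 2 <= L + w * ln B + lq + - mu * lq).
    { destruct (Rle_lt_dec (- ln 2) (L + w * ln B + lq + - mu * lq)) as [|Hlt]; [easy|].
      apply exp_increasing in Hlt. lra. }
    assert (E4 : ln 4 = 2 * ln 2) by (replace 4 with (2 * 2) by ring; rewrite ln_mult; lra).
    unfold lD in *. lra.
Qed.

(** * The lower bound *)

Lemma complexity_complete s n m : complexity_is s n m ->
  exists l, complete (fun i => s (S i)) n l /\ length l = m.
Proof.
  intros (l & Hnd & Hlen & Hl). exists l. split; [split; [easy|] | easy].
  intros u. rewrite Hl. unfold is_factor, factor_at, fac. split.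
  - intros ([|i] & Hi & ->); [lia|]. exists i. now rewrite <- seq_shift, map_map.
  - intros [i ->]. exists (S i). split; [lia|]. now rewrite <- seq_shift, map_map.
Qed.

Lemma quasi_of_sturmian s : sturmian s \/ quasi_sturmian s ->
  exists K, quasi (fun i => s (S i)) K.
Proof.
  intros H. assert (HQ : quasi_sturmian s).
  { destruct H as [H|H]; [|easy]. exists 1%Z, 1%nat. intros n Hn. exists (S n). split; [auto | lia]. }
  clear H. destruct HQ as (k & n0 & H).
  assert (Hap : ~ eventually_periodic (fun i => s (S i))).
  { intros (a & p & Hp & Ht).
    destruct (H (n0 + a + p + Z.to_nat (- k) + 1)%nat) as (m & Hm & Em); [lia|].
    destruct (complexity_complete _ _ _ Hm) as (l & Hl & Hlen).
    pose proof (periodic_bounded _ _ _ _ _ Hp Ht Hl). lia. }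
  assert (Hc : forall n, exists l, complete (fun i => s (S i)) n l).
  { assert (G : forall d n, (n0 <= n + d)%nat -> exists l, complete (fun i => s (S i)) n l).
    { induction d as [|d IH]; intros n Hn.
      - destruct (H n) as (m & Hm & _); [lia|]. destruct (complexity_complete _ _ _ Hm) as (l & Hl & _). eauto.
      - destruct (IH (S n)) as [l Hl]; [lia|]. eexists. exact (complete_trunc _ _ _ Hl). }
    intros n. apply (G n0). lia. }
  (* Morse-Hedlund makes k positive, so [Z.to_nat] loses nothing. *)
  exists (Z.to_nat k), n0. intros n Hn. destruct (H n Hn) as (m & Hm & Em).
  destruct (complexity_complete _ _ _ Hm) as (l & Hl & Hlen). exists l. split; [easy|].
  pose proof (morse_hedlund _ _ _ Hap Hc Hl). lia.
Qed.

Lemma not_always_slow t K n1 x : complexity_from t K n1 -> ~ eventually_periodic t ->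
  prefix_recurrent t -> (100 * S K <= n1)%nat -> x < bound_const - 1 ->
  exists u w n, (n1 <= n)%nat /\ plateau t u w n /\ x * INR w < INR (n + S K).
Proof.
  intros HK Hap Hrec Hn1 Hx. apply NNPP. intros Hno.
  assert (Hr : forall u w n, (n1 <= n)%nat -> plateau t u w n -> INR (n + S K) <= x * INR w).
  { intros u w n Hn HP. apply Rnot_lt_le. intros Hlt. apply Hno. eauto 6. }
  assert (Hs : slow t K n1).
  { repeat (split; [easy|]). split; [|easy]. intros u w n Hn HP. specialize (Hr _ _ _ Hn HP).
    apply INR_le. rewrite !mult_INR. pose proof bound_const_lt. pose proof (pos_INR w).
    replace (INR 100) with 100 by (simpl; ring). replace (INR 151) with 151 by (simpl; ring). nra. }
  destruct (state_exists _ _ _ Hs) as (z & u & v & HS).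
  set (St := fun z u v : R => exists z' u' v', z = INR z' /\ u = INR u' /\ v = INR v' /\ state t K n1 z' u' v').
  apply (no_orbit St x (INR z) (INR u) (INR v) Hx); [|now exists z, u, v].
  split.
  - intros ? ? ? (z' & u' & v' & -> & -> & -> & HS').
    destruct (state_bounds _ _ _ _ _ _ x Hr HS') as (H1 & H2 & H3 & H4).
    rewrite <- plus_INR. repeat split; try (apply lt_0_INR; lia); try (apply lt_INR; lia); try easy.
    apply lt_0_INR. destruct z' as [|z']; [|lia]. exfalso. rewrite Rmult_0_r in H4.
    apply (lt_INR 0) in H1. rewrite plus_INR in H4. pose proof (pos_INR v'). simpl in H1. lra.
  - intros ? ? ? (z' & u' & v' & -> & -> & -> & HS').
    destruct (state_step _ _ _ _ _ _ x Hs Hr HS') as (j & HS'' & H1 & H2).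
    exists j. rewrite <- S_INR, <- !mult_INR, <- !plus_INR. split; [|split; [now apply lt_INR | easy]].
    now exists (z' + S j * v')%nat, (u' + v')%nat, (z' + j * v')%nat.
Qed.

Lemma lower_bound b s : (2 <= b)%nat -> word_over b s -> sturmian s \/ quasi_sturmian s ->
  Rbar_le (Finite bound_const) (irr_exponent (word_value b s)).
Proof.
  intros Hb Hs H. destruct (quasi_of_sturmian s H) as [K0 HQ0]. clear H.
  set (t0 := fun i => s (S i)) in *.
  assert (Ht0 : digits_lt b t0) by (intros j; apply Hs; lia).
  pose proof (quasi_aperiodic _ _ HQ0) as Hap0.
  destruct (quasi_recurrent_tail _ _ HQ0) as (m & K & HQ & Hrec).
  pose proof (quasi_aperiodic _ _ HQ) as Hap. destruct HQ as [n0 HK].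
  assert (HB : 2 <= INR b) by (apply le_INR in Hb; simpl in Hb; lra).
  assert (Hbc : 2 < bound_const).
  { unfold bound_const. assert (3 < sqrt 10); [|lra].
    pose proof (sqrt_sqrt 10 ltac:(lra)). pose proof (sqrt_pos 10). nra. }
  assert (G : forall x, 0 < x < bound_const - 1 -> Rbar_le (1 + x) (irr_exponent (word_value b s))).
  { intros x Hx. apply irr_exponent_ge with (INR b) 1; try lra. intros N.
    (* The gap between x and x' pays for the deleted prefix of length m and the offset [S K]. *)
    set (x' := (x + (bound_const - 1)) / 2).
    destruct (ex_large (x' - x) (x * INR (S K) + x * x' * INR m) N) as [N1 HN1]; [unfold x'; lra|].
    destruct (INR_unbounded N1) as [n1 Hn1].
    destruct (not_always_slow (tail m t0) K (n0 + 100 * S K + n1) x') as (u & w & n & Hn & HP & Hw); auto; try lia.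
    - intros n Hn. apply HK. lia.
    - unfold x'; lra.
    - destruct (HN1 (INR n)) as [Hx1 Hx2]; [assert (INR n1 <= INR n) by (apply le_INR; lia); lra|].
      assert (E : fac t0 n (m + u) = fac t0 n (m + w)) by (rewrite <- !fac_tail; apply HP).
      assert (Huw : (u < w)%nat) by apply HP.
      assert (Hpow : INR b ^ (m + u) < INR b ^ (m + w)) by (apply Rlt_pow; [lra | lia]).
      pose proof (repetition_approx b t0 (m + u) (m + w) n Hb Ht0 E) as Happ.
      assert (Eq : IZR (Z.of_nat b ^ Z.of_nat (m + w) - Z.of_nat b ^ Z.of_nat (m + u)) = INR b ^ (m + w) - INR b ^ (m + u)).
      { now rewrite minus_IZR, <- !pow_IZR, <- !INR_IZR_INZ. }
      assert (Hq0 : (0 < Z.of_nat b ^ Z.of_nat (m + w) - Z.of_nat b ^ Z.of_nat (m + u))%Z).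
      { apply lt_IZR. rewrite Eq. lra. }
      exists (digit_sum b t0 (m + w) - digit_sum b t0 (m + u))%Z,
        (Z.of_nat b ^ Z.of_nat (m + w) - Z.of_nat b ^ Z.of_nat (m + u))%Z, (INR (m + w)), (INR n).
      split; [easy|]. split; [|split; [easy|split]].
      + rewrite Eq, Rpower_pow by lra. pose proof (pow_lt (INR b) (m + u)). lra.
      + rewrite plus_INR in *. assert (Hx' : 0 < x') by (unfold x'; lra).
        apply (Rmult_le_reg_l x'); [easy|]. nra.
      + split.
        * apply Rabs_pos_lt. intros E0. apply (val_irrational b t0
            (digit_sum b t0 (m + w) - digit_sum b t0 (m + u)) _ Hb Ht0 Hap0 Hq0).
          apply Rminus_diag_uniq. exact E0.
        * rewrite Eq. rewrite Rpower_Ropp, Rpower_pow, Rmult_1_l by lra. exact Happ. }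
  destruct (irr_exponent (word_value b s)) as [r| |]; simpl in *; try easy.
  - destruct (Rle_lt_dec bound_const r) as [|Hr]; [easy | exfalso].
    set (x := Rmax ((r - 1 + (bound_const - 1)) / 2) ((bound_const - 1) / 2)).
    pose proof (Rmax_l ((r - 1 + (bound_const - 1)) / 2) ((bound_const - 1) / 2)).
    pose proof (Rmax_r ((r - 1 + (bound_const - 1)) / 2) ((bound_const - 1) / 2)).
    assert (Hx : 0 < x < bound_const - 1).
    { split; [unfold x; lra|]. apply Rmax_lub_lt; lra. }
    specialize (G x Hx). unfold x in *. lra.
  - apply (G 1). lra.
Qed.

(** * The extremal word *)

(** A pair (A, N) is the element A + N sqrt 10 of Z[sqrt 10]. When its conjugate [cj] is bounded,
    [tr] is 2 N sqrt 10 up to a bounded error: a measure of the position N that the unit multiplies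
    exactly. *)
Definition tr (x : Z * Z) : R := IZR (fst x) + IZR (snd x) * sqrt 10.
Definition cj (x : Z * Z) : R := IZR (fst x) - IZR (snd x) * sqrt 10.

(* Let pi = (3 c + 2 p, p) and x = (A, n + 1). The congruence says that A = 3 L + 2 n + 1 for an integer
   L, and then cj x = 3 (L - (n theta0 + rho0)) and cj pi = -3 (p theta0 - c): a hit is an integer L
   lying between n theta0 + rho0 and (n + p) theta0 + rho0 - c. *)
Definition hit (pi x : Z * Z) : Prop :=
  ((fst x + snd x) mod 3 = 2)%Z /\ cj x * cj pi <= 0 /\ 0 <= (cj x + cj pi) * cj pi.

(* Multiplication by the fundamental unit 3 + sqrt 10. *)
Definition scale (x : Z * Z) : Z * Z := (3 * fst x + 10 * snd x, fst x + 3 * snd x)%Z.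
Definition unscale (x : Z * Z) : Z * Z := (10 * snd x - 3 * fst x, fst x - 3 * snd x)%Z.

Lemma sqrt10_sqr : sqrt 10 * sqrt 10 = 10.
Proof. apply sqrt_sqrt. lra. Qed.

Lemma sqrt10_bounds : 3162277 / 1000000 < sqrt 10 < 3162278 / 1000000.
Proof.
  pose proof sqrt10_sqr. pose proof (sqrt_pos 10). split; apply Rnot_le_lt; intros H1.
  - pose proof (Rmult_le_compat _ _ _ _ H0 H0 H1 H1). lra.
  - assert (H2 : 0 <= 3162278 / 1000000) by lra.
    pose proof (Rmult_le_compat _ _ _ _ H2 H2 H1 H1). lra.
Qed.

Lemma scale_unscale x : scale (unscale x) = x.
Proof. destruct x as [A N]. unfold scale, unscale; cbn [fst snd]. f_equal; lia. Qed.

Lemma tr_scale x : tr (scale x) = (3 + sqrt 10) * tr x.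
Proof.
  unfold tr, scale; cbn [fst snd]. rewrite !plus_IZR, !mult_IZR.
  apply Rminus_diag_uniq. replace (_ - _) with ((10 - sqrt 10 * sqrt 10) * IZR (snd x)) by ring.
  rewrite sqrt10_sqr. ring.
Qed.

Lemma cj_scale x : cj (scale x) = (3 - sqrt 10) * cj x.
Proof.
  unfold cj, scale; cbn [fst snd]. rewrite !plus_IZR, !mult_IZR.
  apply Rminus_diag_uniq. replace (_ - _) with ((10 - sqrt 10 * sqrt 10) * IZR (snd x)) by ring.
  rewrite sqrt10_sqr. ring.
Qed.

Lemma snd_tr_cj x : IZR (snd x) = (tr x - cj x) / (2 * sqrt 10).
Proof. unfold tr, cj. field. pose proof sqrt10_bounds. lra. Qed.

Lemma cj_scale_bound x : Rabs (cj x) <= 1 -> Rabs (cj (scale x)) <= 1.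
Proof.
  intros H. rewrite cj_scale, Rabs_mult. pose proof sqrt10_bounds. rewrite <- (Rmult_1_l 1).
  apply Rmult_le_compat; try apply Rabs_pos; [apply Rabs_le; lra | easy].
Qed.

Lemma mod3_scale x : ((fst (scale x) + snd (scale x)) mod 3 = (fst x + snd x) mod 3)%Z.
Proof.
  unfold scale; cbn [fst snd].
  replace (3 * fst x + 10 * snd x + (fst x + 3 * snd x))%Z with
    ((fst x + snd x) + (fst x + 4 * snd x) * 3)%Z by ring.
  apply Z_mod_plus_full.
Qed.

Definition no_hit_between (pi l h : Z * Z) : Prop :=
  forall x, hit pi x -> tr l < tr x < tr h -> False.

(** The unit preserves the class mod 3, multiplies the sign conditions of [hit] by the square of 3 -
    sqrt 10 and stretches [tr], so every hit of [scale pi] is the image of a hit of pi. *)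
Lemma no_hit_scale pi l h : no_hit_between pi l h ->
  no_hit_between (scale pi) (scale l) (scale h).
Proof.
  intros H x. rewrite <- (scale_unscale x). generalize (unscale x). clear x.
  intros x (H1 & H2 & H3) H4. rewrite mod3_scale in H1. rewrite !cj_scale in *. rewrite !tr_scale in *.
  pose proof sqrt10_bounds. assert (Hp : 0 < (3 - sqrt 10) * (3 - sqrt 10)) by nra.
  apply (H x).
  - split; [easy|]. split; apply (Rmult_le_reg_l _ _ _ Hp); lra.
  - split; apply (Rmult_lt_reg_l (3 + sqrt 10)); lra.
Qed.

(** N = (tr - cj) / (2 sqrt 10), and two conjugates in [-1, 1] shift N by less than one relative to
    each other. A window for [tr] thus becomes a finite box. *)
Lemma tr_lt_cases x y : Rabs (cj x) <= 1 -> Rabs (cj y) <= 1 -> tr x < tr y ->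
  (snd x <= snd y /\ (snd x = snd y -> fst x < fst y))%Z.
Proof.
  intros Hx Hy H. apply Rabs_le_between in Hx, Hy. pose proof sqrt10_bounds as Hs.
  unfold tr, cj in *. split.
  - apply Z.nlt_ge. intros Hlt. apply Zlt_le_succ, IZR_le in Hlt. rewrite succ_IZR in Hlt. nra.
  - intros E. rewrite E in H. apply lt_IZR. lra.
Qed.

(* The integer d bounds the conjugate of pi from above in units of 10^-6. *)
Lemma no_hit_box pi l h (d : Z) : Rabs (cj l) <= 1 -> Rabs (cj h) <= 1 -> (0 <= snd l)%Z ->
  0 < Rabs (cj pi) <= IZR d / 1000000 -> (d <= 1000000)%Z ->
  (forall A N : Z, ((A + N) mod 3 = 2)%Z -> (snd l <= N <= snd h)%Z ->
    (N = snd l -> fst l < A)%Z -> (N = snd h -> A < fst h)%Z ->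
    0 < cj pi /\ (3162277 * N - d <= 1000000 * A <= 3162278 * N)%Z \/
    cj pi < 0 /\ (3162277 * N <= 1000000 * A <= 3162278 * N + d)%Z -> False) ->
  no_hit_between pi l h.
Proof.
  intros Hl Hh Hl0 Hpi Hd H [A N] (Hm & H1 & H2) [H3 H4]. apply IZR_le in Hd.
  set (x := (A, N)) in *.
  assert (Hx : 0 < cj pi /\ - cj pi <= cj x <= 0 \/ cj pi < 0 /\ 0 <= cj x <= - cj pi).
  { destruct (Rtotal_order (cj pi) 0) as [Hn|[Hn|Hn]].
    - right. split; [easy|]. split; nra.
    - rewrite Hn, Rabs_R0 in Hpi. lra.
    - left. split; [easy|]. split; nra. }
  assert (Hx1 : Rabs (cj x) <= 1).
  { destruct Hpi as [_ Hpi]. apply Rabs_le_between in Hpi. apply Rabs_le. lra. }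
  destruct (tr_lt_cases _ _ Hl Hx1 H3) as [H5 H6], (tr_lt_cases _ _ Hx1 Hh H4) as [H7 H8].
  apply (H A N Hm); try (split; easy).
  - intros E. apply H6. now symmetry.
  - exact H8.
  - destruct Hpi as [_ Hpi]. apply Rabs_le_between in Hpi. pose proof sqrt10_bounds as Hs.
    assert (HN : 0 <= IZR N) by (apply IZR_le; simpl in H5; lia).
    assert (Ex : cj x = IZR A - IZR N * sqrt 10) by reflexivity. rewrite Ex in Hx.
    assert (Hb : IZR N * (3162277 / 1000000) <= IZR N * sqrt 10 <= IZR N * (3162278 / 1000000))
      by (split; apply Rmult_le_compat_l; lra).
    destruct Hx as [[Hp Hx]|[Hp Hx]]; [left | right]; (split; [easy|]);
      split; apply le_IZR; rewrite ?minus_IZR, ?plus_IZR, !mult_IZR; lra.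
Qed.

Lemma cj_eq x : cj x = IZR (fst x) - IZR (snd x) * sqrt 10.
Proof. reflexivity. Qed.

Ltac cj_bound := rewrite ?cj_eq; cbn [fst snd]; pose proof sqrt10_bounds; lra.

Ltac box d :=
  apply (no_hit_box _ _ _ d); cbn [fst snd];
  [ apply Rabs_le; cj_bound | apply Rabs_le; cj_bound | lia
  | split; [apply Rabs_pos_lt; cj_bound | apply Rabs_le; cj_bound] | lia
  | intros A N Hm H1 H2 H3 [[Hp H4]|[Hp H4]];
    [ try (exfalso; revert Hp; cj_bound) | try (exfalso; revert Hp; cj_bound)]; 
    Z.div_mod_to_equations; try lia ].

(** The argument of [box] is the absolute value of cj pi in units of 10^-6, rounded up. *)
Lemma no_hit_0 : no_hit_between (9, 3)%Z (0, 0)%Z (13, 4)%Z.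
Proof. box 486834%Z. Qed.

Lemma no_hit_1 : no_hit_between (7, 2)%Z (6, 2)%Z (22, 7)%Z.
Proof. box 675447%Z. Qed.

Lemma no_hit_2 : no_hit_between (16, 5)%Z (0, 0)%Z (22, 7)%Z.
Proof. box 188616%Z. Qed.

Lemma no_hit_3 : no_hit_between (9, 3)%Z (13, 4)%Z (38, 12)%Z.
Proof. box 486834%Z. Qed.

Lemma no_hit_4 : no_hit_between (25, 8)%Z (0, 0)%Z (38, 12)%Z.
Proof. box 298225%Z. Qed.

Lemma no_hit_5 : no_hit_between (16, 5)%Z (22, 7)%Z (79, 25)%Z.
Proof. box 188616%Z. Qed.

(** * Floors along the rotation and their jumps *)

Definition fl (n : nat) : Z := Int_part (INR n * theta0 + rho0).

Lemma fl_spec n : IZR (fl n) <= (sqrt 10 * (INR n + 1) - 2 * INR n - 1) / 3 < IZR (fl n) + 1.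
Proof.
  unfold fl. pose proof (base_Int_part (INR n * theta0 + rho0)) as H.
  replace ((sqrt 10 * (INR n + 1) - 2 * INR n - 1) / 3) with (INR n * theta0 + rho0)
    by (unfold theta0, rho0; field). lra.
Qed.

Lemma extremal_digit n : Z.of_nat (extremal_word n) = (fl (S n) - fl n)%Z /\ (extremal_word n <= 1)%nat.
Proof.
  assert (H : (0 <= fl (S n) - fl n <= 1)%Z).
  { pose proof (fl_spec n). pose proof (fl_spec (S n)) as H1. rewrite S_INR in H1.
    pose proof sqrt10_bounds.
    assert (fl n < fl (S n) + 1)%Z by (apply lt_IZR; rewrite plus_IZR; lra).
    assert (fl (S n) < fl n + 2)%Z by (apply lt_IZR; rewrite plus_IZR; lra). lia. }
  unfold extremal_word. change (Int_part (INR (S n) * theta0 + rho0)) with (fl (S n)).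
  change (Int_part (INR n * theta0 + rho0)) with (fl n). lia.
Qed.

(** The number of letters 1 in the window of length p at n, compared with c. Equal values at n and n
    + 1 mean that the letters at n and n + p agree. *)
Definition jump (p : nat) (c : Z) (n : nat) : Z := (fl (n + p) - fl n - c)%Z.

Lemma jump_range pi p c n : snd pi = Z.of_nat p -> fst pi = (3 * c + 2 * snd pi)%Z ->
  Rabs (cj pi) <= 1 ->
  (0 < cj pi -> (-1 <= jump p c n <= 0)%Z) /\ (cj pi < 0 -> (0 <= jump p c n <= 1)%Z).
Proof.
  intros Hp Hc Hpi. apply Rabs_le_between in Hpi.
  pose proof (fl_spec n) as H1. pose proof (fl_spec (n + p)) as H2. rewrite plus_INR in H2.
  assert (E : cj pi = 3 * IZR c + 2 * INR p - INR p * sqrt 10).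
  { unfold cj. rewrite Hc, plus_IZR, !mult_IZR, Hp, <- INR_IZR_INZ. ring. }
  unfold jump. split; intros Hs.
  - assert (fl (n + p) - fl n - c < 1)%Z by (apply lt_IZR; rewrite !minus_IZR; lra).
    assert (-2 < fl (n + p) - fl n - c)%Z by (apply lt_IZR; rewrite !minus_IZR; lra). lia.
  - assert (fl (n + p) - fl n - c < 2)%Z by (apply lt_IZR; rewrite !minus_IZR; lra).
    assert (-1 < fl (n + p) - fl n - c)%Z by (apply lt_IZR; rewrite !minus_IZR; lra). lia.
Qed.

(** The signs are strict because an integer equal to an endpoint need not separate the two floors;
    [hit] is weak so that its absence forces them to agree. *)
Lemma jump_hit pi p c n x : snd pi = Z.of_nat p -> fst pi = (3 * c + 2 * snd pi)%Z ->
  snd x = Z.of_nat (S n) -> ((fst x + snd x) mod 3 = 2)%Z -> cj x * cj pi < 0 ->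
  0 < (cj x + cj pi) * cj pi -> jump p c n <> 0%Z.
Proof.
  intros Hp Hc Hn Hm H1 H2.
  pose proof (fl_spec n) as F1. pose proof (fl_spec (n + p)) as F2. rewrite plus_INR in F2.
  assert (E : cj pi = 3 * IZR c + 2 * INR p - INR p * sqrt 10).
  { unfold cj. rewrite Hc, plus_IZR, !mult_IZR, Hp, <- INR_IZR_INZ. ring. }
  assert (HL : exists L, fst x = (3 * L + 2 * Z.of_nat (S n) - 1)%Z).
  { exists ((fst x - 2 * Z.of_nat (S n) + 1) / 3)%Z. rewrite Hn in Hm. Z.div_mod_to_equations. lia. }
  destruct HL as [L HL].
  assert (Ex : cj x = 3 * IZR L + 2 * INR n + 1 - (INR n + 1) * sqrt 10).
  { unfold cj. rewrite HL, Hn, minus_IZR, plus_IZR, !mult_IZR, <- INR_IZR_INZ, S_INR. ring. }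
  unfold jump. destruct (Rtotal_order (cj pi) 0) as [Hs|[Hs|Hs]].
  - assert (0 < cj x) by nra. assert (cj x + cj pi < 0) by nra.
    assert (fl n < L)%Z by (apply lt_IZR; lra).
    assert (L + c < fl (n + p) + 1)%Z by (apply lt_IZR; rewrite !plus_IZR; lra). lia.
  - rewrite Hs in H1. lra.
  - assert (cj x < 0) by nra. assert (0 < cj x + cj pi) by nra.
    assert (L < fl n + 1)%Z by (apply lt_IZR; rewrite plus_IZR; lra).
    assert (fl (n + p) < L + c)%Z by (apply lt_IZR; rewrite !plus_IZR; lra). lia.
Qed.

Lemma jump_zero pi p c n : snd pi = Z.of_nat p -> fst pi = (3 * c + 2 * snd pi)%Z ->
  (forall x, snd x = Z.of_nat (S n) -> ~ hit pi x) -> jump p c n = 0%Z.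
Proof.
  intros Hp Hc H.
  pose proof (fl_spec n) as F1. pose proof (fl_spec (n + p)) as F2. rewrite plus_INR in F2.
  assert (E : cj pi = 3 * IZR c + 2 * INR p - INR p * sqrt 10).
  { unfold cj. rewrite Hc, plus_IZR, !mult_IZR, Hp, <- INR_IZR_INZ. ring. }
  assert (G : forall L, let y := cj (3 * L + 2 * Z.of_nat (S n) - 1, Z.of_nat (S n))%Z in
    y * cj pi <= 0 -> 0 <= (y + cj pi) * cj pi -> False).
  { intros L y H1 H2. apply (H (3 * L + 2 * Z.of_nat (S n) - 1, Z.of_nat (S n))%Z); [easy|].
    split; [|split; easy]. cbn [fst snd]. Z.div_mod_to_equations. lia. }
  assert (Ey : forall L, cj (3 * L + 2 * Z.of_nat (S n) - 1, Z.of_nat (S n))%Z =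
    3 * IZR L + 2 * INR n + 1 - (INR n + 1) * sqrt 10).
  { intros L. unfold cj. cbn [fst snd].
    rewrite minus_IZR, plus_IZR, !mult_IZR, <- INR_IZR_INZ, S_INR. ring. }
  unfold jump. destruct (Z.lt_total (fl (n + p) - c) (fl n)) as [Hl|[Hl|Hl]]; [exfalso | lia | exfalso].
  - apply (G (fl n)); cbv zeta; rewrite Ey;
      assert (IZR (fl (n + p)) - IZR c + 1 <= IZR (fl n))
        by (rewrite <- minus_IZR, <- plus_IZR; apply IZR_le; lia).
    + assert (0 < cj pi) by lra. nra.
    + assert (0 < cj pi) by lra. apply Rmult_le_pos; lra.
  - apply (G (fl (n + p) - c)%Z); cbv zeta; rewrite Ey, minus_IZR;
      assert (IZR (fl n) + 1 <= IZR (fl (n + p)) - IZR c)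
        by (rewrite <- minus_IZR, <- plus_IZR; apply IZR_le; lia).
    + assert (cj pi < 0) by lra. nra.
    + assert (cj pi < 0) by lra. nra.
Qed.

Lemma val_plus_eq b x y x' y' : (2 <= b)%nat -> digits_lt b x -> digits_lt b y ->
  digits_lt b x' -> digits_lt b y' -> (forall i, x i + y i = x' i + y' i)%nat ->
  val b x + val b y = val b x' + val b y'.
Proof.
  intros Hb Hx Hy Hx' Hy' E. unfold val.
  rewrite <- !Series_plus by now apply ex_series_val.
  apply Series_ext. intros i. unfold Rdiv. rewrite <- !Rmult_plus_distr_r, <- !plus_INR. now rewrite E.
Qed.

Lemma val_first_one b e m : (2 <= b)%nat -> digits_lt b e -> (forall i, (i < m)%nat -> e i = 0%nat) ->
  e m = 1%nat -> / INR b ^ S m <= val b e <= / INR b ^ m.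
Proof.
  intros Hb He H0 H1.
  assert (HB : 2 <= INR b) by (apply le_INR in Hb; simpl in Hb; lra).
  assert (Hp : 0 < INR b ^ m) by (apply pow_lt; lra).
  assert (E : INR b ^ m * val b e = val b (tail m e)).
  { rewrite val_shift by easy. rewrite (digit_sum_ext b e (fun _ => 0%nat)) by easy.
    replace (digit_sum b (fun _ => 0%nat) m) with 0%Z; [ring|].
    clear. induction m as [|m IH]; simpl; lia. }
  pose proof (val_step b (tail m e) Hb (digits_lt_tail _ _ m He)) as Hs.
  replace (tail m e 0) with 1%nat in Hs by (unfold tail; now rewrite Nat.add_0_r).
  pose proof (val_bounds b _ Hb (digits_lt_tail _ _ m He)).
  pose proof (val_bounds b _ Hb (digits_lt_tail _ _ 1 (digits_lt_tail _ _ m He))).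
  change (INR 1) with 1 in Hs. split.
  - apply (Rmult_le_reg_l (INR b ^ S m)); [apply pow_lt; lra|].
    rewrite Rinv_r by (apply pow_nonzero; lra). simpl. rewrite Rmult_assoc, E. lra.
  - apply (Rmult_le_reg_l (INR b ^ m)); [easy|]. rewrite Rinv_r, E by lra. lra.
Qed.

(** Since e starts with 0, dropping its first digit multiplies its value by b. *)
Lemma val_alternating b t e u w : (2 <= b)%nat -> digits_lt b t -> digits_lt b e -> e 0%nat = 0%nat ->
  (forall i, t (w + i) + e i = t (u + i) + e (S i))%nat ->
  val b (tail w t) - val b (tail u t) = (INR b - 1) * val b e.
Proof.
  intros Hb Ht He He0 E.
  pose proof (val_plus_eq b (tail w t) e (tail u t) (tail 1 e) Hb (digits_lt_tail _ _ w Ht) He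
    (digits_lt_tail _ _ u Ht) (digits_lt_tail _ _ 1 He)) as H.
  pose proof (val_step b e Hb He) as Hs. rewrite He0 in Hs. simpl INR in Hs.
  specialize (H E). lra.
Qed.

(* With D = jump p c, the digit differences t (u + p + i) - t (u + i) are the increments of D, and
   D takes only the values 0 and sigma: summation by parts makes all terms have the same sign. *)
Lemma window_approx b pi l h : (2 <= b)%nat ->
  ((fst pi + snd pi) mod 3 = 0)%Z -> (0 < snd pi)%Z -> (0 <= snd l)%Z -> (snd l + 3 <= snd h)%Z ->
  Rabs (cj pi) <= 1 -> Rabs (cj l) <= 1 -> Rabs (cj h) <= 1 ->
  ((fst h + snd h) mod 3 = 2)%Z -> cj h * cj pi < 0 -> 0 < (cj h + cj pi) * cj pi ->
  no_hit_between pi l h ->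
  exists p q : Z, (0 < q)%Z /\ IZR q <= INR b ^ Z.to_nat (snd l + snd pi) /\
    (INR b - 1) * / INR b ^ S (Z.to_nat (snd h - snd l - 2)) <=
      Rabs (IZR q * word_value b extremal_word - IZR p) <=
    (INR b - 1) * / INR b ^ Z.to_nat (snd h - snd l - 2).
Proof.
  intros Hb Hmp Hp Hl Hlh Cp Cl Ch Hmh Hh1 Hh2 Hno.
  assert (HB : 2 <= INR b) by (apply le_INR in Hb; simpl in Hb; lra).
  set (t := fun i => extremal_word (S i)).
  assert (Ht : digits_lt b t) by (intros j; destruct (extremal_digit (S j)); unfold t; lia).
  (* The 2 in m collects two shifts: the word starts at index 1, and the jump at n belongs to pairs
     with second coordinate n + 1. *)
  set (u := Z.to_nat (snd l)). set (p := Z.to_nat (snd pi)). set (m := Z.to_nat (snd h - snd l - 2)).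
  assert (Ep : snd pi = Z.of_nat p) by lia.
  assert (Hc : exists c, fst pi = (3 * c + 2 * snd pi)%Z).
  { exists ((fst pi - 2 * snd pi) / 3)%Z. Z.div_mod_to_equations. lia. }
  destruct Hc as [c Hc].
  assert (Hzero : forall i, (i < m)%nat -> jump p c (u + 1 + i) = 0%Z).
  { intros i Hi. apply (jump_zero pi); [easy | easy |]. intros x Hx (Hm & H1 & H2).
    assert (Cx : Rabs (cj x) <= 1).
    { apply Rabs_le_between in Cp. destruct (Rtotal_order (cj pi) 0) as [Hn|[Hn|Hn]].
      - apply Rabs_le. split; nra.
      - rewrite Hn in Hh1. lra.
      - apply Rabs_le. split; nra. }
    apply (Hno x); [split; [easy | split; easy]|].
    apply Rabs_le_between in Cx, Cl, Ch. pose proof sqrt10_bounds as Hs.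
    assert (Hlx : (snd l + 1 <= snd x)%Z) by lia. assert (Hxh : (snd x + 1 <= snd h)%Z) by lia.
    apply IZR_le in Hlx, Hxh. rewrite plus_IZR in Hlx, Hxh.
    unfold tr, cj in *. split; nra. }
  assert (Hone : jump p c (u + 1 + m) <> 0%Z).
  { apply (jump_hit pi p c _ h); try easy. lia. }
  assert (Hd : forall i, (Z.of_nat (t (u + p + i)%nat) - Z.of_nat (t (u + i)%nat) =
    jump p c (u + 1 + S i) - jump p c (u + 1 + i))%Z).
  { intros i. unfold t, jump. destruct (extremal_digit (S (u + p + i))) as [-> _].
    destruct (extremal_digit (S (u + i))) as [-> _].
    replace (u + 1 + S i + p)%nat with (S (S (u + p + i))) by lia.
    replace (u + 1 + i + p)%nat with (S (u + p + i)) by lia.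
    replace (u + 1 + S i)%nat with (S (S (u + i))) by lia.
    replace (u + 1 + i)%nat with (S (u + i)) by lia. lia. }
  assert (Hm1 : (1 <= m)%nat) by lia.
  (* The sign of cj pi determines that of all jumps, so their absolute values form a digit sequence
     whose first nonzero digit is at m. *)
  assert (G : exists e, digits_lt b e /\ (forall i, (i < m)%nat -> e i = 0%nat) /\ e m = 1%nat /\
    Rabs (val b (tail (u + p) t) - val b (tail u t)) = (INR b - 1) * val b e).
  { assert (Hcp : cj pi <> 0) by (intros E; rewrite E in Hh1; lra).
    destruct (Rlt_le_dec (cj pi) 0) as [Hs|Hs].
    - exists (fun i => Z.to_nat (jump p c (u + 1 + i))).
      assert (Hr : forall i, (0 <= jump p c (u + 1 + i) <= 1)%Z).
      { intros i. now apply (jump_range pi p c (u + 1 + i) Ep Hc Cp). }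
      assert (He : digits_lt b (fun i => Z.to_nat (jump p c (u + 1 + i)))).
      { intros i. specialize (Hr i). lia. }
      split; [easy|]. split; [intros i Hi; now rewrite Hzero|].
      split; [specialize (Hr m); lia|].
      rewrite (val_alternating b t (fun i => Z.to_nat (jump p c (u + 1 + i))) u (u + p)); auto.
      + rewrite Rabs_pos_eq; [easy|]. pose proof (val_bounds _ _ Hb He). apply Rmult_le_pos; lra.
      + rewrite Hzero; [easy | lia].
      + intros i. specialize (Hd i). pose proof (Hr i). pose proof (Hr (S i)). lia.
    - exists (fun i => Z.to_nat (- jump p c (u + 1 + i))).
      assert (Hr : forall i, (-1 <= jump p c (u + 1 + i) <= 0)%Z).
      { intros i. apply (jump_range pi p c (u + 1 + i) Ep Hc Cp). lra. }
      assert (He : digits_lt b (fun i => Z.to_nat (- jump p c (u + 1 + i)))).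
      { intros i. specialize (Hr i). lia. }
      split; [easy|]. split; [intros i Hi; now rewrite Hzero|].
      split; [specialize (Hr m); lia|].
      rewrite Rabs_minus_sym.
      rewrite (val_alternating b t (fun i => Z.to_nat (- jump p c (u + 1 + i))) (u + p) u); auto.
      + rewrite Rabs_pos_eq; [easy|]. pose proof (val_bounds _ _ Hb He). apply Rmult_le_pos; lra.
      + rewrite Hzero; [easy | lia].
      + intros i. specialize (Hd i). pose proof (Hr i). pose proof (Hr (S i)). lia. }
  destruct G as (e & He & He0 & He1 & Ev).
  assert (Hpow : INR b ^ u < INR b ^ (u + p)) by (apply Rlt_pow; [lra | lia]).
  set (q := (Z.of_nat b ^ Z.of_nat (u + p) - Z.of_nat b ^ Z.of_nat u)%Z).
  assert (Eq : IZR q = INR b ^ (u + p) - INR b ^ u).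
  { unfold q. now rewrite minus_IZR, <- !pow_IZR, <- !INR_IZR_INZ. }
  exists (digit_sum b t (u + p) - digit_sum b t u)%Z, q.
  split; [apply lt_IZR; rewrite Eq; lra|]. split.
  - rewrite Eq. replace (Z.to_nat (snd l + snd pi)) with (u + p)%nat by lia.
    pose proof (pow_lt (INR b) u). lra.
  - rewrite Eq. change (word_value b extremal_word) with (val b t).
    rewrite shift_diff, Ev by easy. pose proof (val_first_one b e m Hb He He0 He1).
    split; apply Rmult_le_compat_l; lra.
Qed.

(** * Self-similar families of approximations *)

(** Here pi is the period, l the place where the repetition starts and h the hit that ends it. As
    [scale] mixes the coordinates, the inequalities on first coordinates let those on second
    coordinates be inherited. *)
Definition admissible (pi l h : Z * Z) : Prop :=
  (((fst pi + snd pi) mod 3 = 0)%Z /\ ((fst h + snd h) mod 3 = 2)%Z) /\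
  ((0 <= fst pi /\ 0 < snd pi)%Z /\ (0 <= fst l /\ 0 <= snd l)%Z /\
   (fst l <= fst h /\ snd l + 3 <= snd h)%Z) /\
  (Rabs (cj pi) <= 1 /\ Rabs (cj l) <= 1 /\ Rabs (cj h) <= 1) /\
  (cj h * cj pi < 0 /\ 0 < (cj h + cj pi) * cj pi) /\ no_hit_between pi l h.

Lemma admissible_scale pi l h : admissible pi l h -> admissible (scale pi) (scale l) (scale h).
Proof.
  intros ((H1 & H2) & H3 & (H4 & H5 & H6) & (H7 & H8) & H9).
  split; [now rewrite !mod3_scale|]. split; [unfold scale; cbn [fst snd]; lia|].
  split; [auto using cj_scale_bound|]. split; [|now apply no_hit_scale].
  rewrite !cj_scale. pose proof sqrt10_bounds.
  assert (Hp : 0 < (3 - sqrt 10) * (3 - sqrt 10)) by nra.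
  pose proof (Rmult_lt_compat_l _ _ _ Hp H7). pose proof (Rmult_lt_compat_l _ _ _ Hp H8). lra.
Qed.

(* The interleaved families below have denominators of size b^(om^k level_start) and
   linear forms |q xi - p| of size b^-(om^k level_end), where om = 3 + sqrt 10. *)
Definition level_start (pi l : Z * Z) : R := (tr l + tr pi) / (2 * sqrt 10).
Definition level_end (l h : Z * Z) : R := (tr h - tr l) / (2 * sqrt 10).

(** The factor b^4 absorbs b - 1 and the rounding of the levels to integer exponents. *)
Definition approximated (b : nat) (w w' : R) : Prop :=
  exists p q : Z, (0 < q)%Z /\ IZR q <= INR b ^ 4 * Rpower (INR b) w /\
    / INR b ^ 4 * Rpower (INR b) (- w') <= Rabs (IZR q * word_value b extremal_word - IZR p) <=
    INR b ^ 4 * Rpower (INR b) (- w').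

Lemma pow_Ztonat B z : 0 < B -> (0 <= z)%Z -> B ^ Z.to_nat z = Rpower B (IZR z).
Proof.
  intros HB Hz. rewrite <- Rpower_pow by easy. f_equal. rewrite INR_IZR_INZ. f_equal. lia.
Qed.

Lemma admissible_approx b pi l h : (2 <= b)%nat -> admissible pi l h ->
  approximated b (level_start pi l) (level_end l h).
Proof.
  intros Hb ((H1 & H2) & H3 & (H4 & H5 & H6) & (H7 & H8) & H9).
  destruct (window_approx b pi l h) as (p & q & Hq & Hqle & Hlo & Hhi); try easy.
  exists p, q. split; [easy|].
  assert (HB : 2 <= INR b) by (apply le_INR in Hb; simpl in Hb; lra).
  set (B := INR b) in *.
  assert (Hs := sqrt10_bounds).
  assert (Hdiv : forall r, Rabs r <= 2 -> -1 <= r / (2 * sqrt 10) <= 1).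
  { intros r Hr. apply Rabs_le_between in Hr. split.
    - apply (Rmult_le_reg_r (2 * sqrt 10)); [lra|]. unfold Rdiv. rewrite Rmult_assoc, Rinv_l; lra.
    - apply (Rmult_le_reg_r (2 * sqrt 10)); [lra|]. unfold Rdiv. rewrite Rmult_assoc, Rinv_l; lra. }
  apply Rabs_le_between in H4, H5, H6.
  assert (Hw : IZR (snd l + snd pi) <= level_start pi l + 1).
  { rewrite plus_IZR, !snd_tr_cj. unfold level_start.
    assert (Hr : Rabs (- (cj l + cj pi)) <= 2) by (apply Rabs_le; lra). apply Hdiv in Hr.
    replace ((tr l - cj l) / (2 * sqrt 10) + (tr pi - cj pi) / (2 * sqrt 10)) with
      ((tr l + tr pi) / (2 * sqrt 10) + - (cj l + cj pi) / (2 * sqrt 10)) by (field; lra). lra. }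
  assert (Hw' : level_end l h - 3 <= IZR (snd h - snd l - 2) <= level_end l h - 1).
  { rewrite !minus_IZR, !snd_tr_cj. unfold level_end.
    assert (Hr : Rabs (- (cj h - cj l)) <= 2) by (apply Rabs_le; lra). apply Hdiv in Hr.
    replace ((tr h - cj h) / (2 * sqrt 10) - (tr l - cj l) / (2 * sqrt 10)) with
      ((tr h - tr l) / (2 * sqrt 10) + - (cj h - cj l) / (2 * sqrt 10)) by (field; lra). lra. }
  assert (HP : forall y y', y <= y' -> Rpower B y <= Rpower B y') by (intros; apply Rle_Rpower; lra).
  assert (HBn : forall n y, B ^ n * Rpower B y = Rpower B (INR n + y)).
  { intros n y. rewrite Rpower_plus, Rpower_pow by lra. easy. }
  assert (E4 : / B ^ 4 = Rpower B (- INR 4)).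
  { now rewrite Rpower_Ropp, Rpower_pow by lra. }
  assert (H0 : forall y, 0 < Rpower B y) by (intros; apply exp_pos).
  rewrite !HBn, E4, <- Rpower_plus. change (INR 4) with (1 + 1 + 1 + 1).
  split; [|split].
  - apply Rle_trans with (1 := Hqle). rewrite pow_Ztonat by (lra || lia). apply HP. lra.
  - refine (Rle_trans _ _ _ _ Hlo). rewrite <- (Rmult_1_l (Rpower _ _)).
    apply Rmult_le_compat; [lra | left; apply H0 | lra |].
    simpl pow. rewrite Rinv_mult, pow_Ztonat, <- Rpower_Ropp by (lra || lia).
    rewrite <- (Rpower_1 B) at 2 by lra. rewrite <- Rpower_Ropp, <- Rpower_plus. apply HP. lra.
  - apply Rle_trans with (1 := Hhi). rewrite pow_Ztonat, <- Rpower_Ropp by (lra || lia).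
    apply Rle_trans with (Rpower B 1 * Rpower B (- IZR (snd h - snd l - 2))).
    + apply Rmult_le_compat_r; [left; apply H0|]. rewrite Rpower_1; lra.
    + rewrite <- Rpower_plus. apply HP. lra.
Qed.

Lemma admissible_family b pi l h k : (2 <= b)%nat -> admissible pi l h ->
  approximated b ((3 + sqrt 10) ^ k * level_start pi l) ((3 + sqrt 10) ^ k * level_end l h).
Proof.
  intros Hb. revert pi l h. induction k as [|k IH]; intros pi l h H.
  - rewrite !Rmult_1_l. now apply admissible_approx.
  - specialize (IH _ _ _ (admissible_scale _ _ _ H)).
    unfold level_start, level_end in *. rewrite !tr_scale in IH. simpl. unfold Rdiv in *.
    replace ((3 + sqrt 10) * (3 + sqrt 10) ^ k * ((tr l + tr pi) * / (2 * sqrt 10))) with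
      ((3 + sqrt 10) ^ k * (((3 + sqrt 10) * tr l + (3 + sqrt 10) * tr pi) * / (2 * sqrt 10))) by ring.
    replace ((3 + sqrt 10) * (3 + sqrt 10) ^ k * ((tr h - tr l) * / (2 * sqrt 10))) with
      ((3 + sqrt 10) ^ k * (((3 + sqrt 10) * tr h - (3 + sqrt 10) * tr l) * / (2 * sqrt 10))) by ring.
    exact IH.
Qed.

Ltac admissible_base :=
  unfold admissible; cbn [fst snd];
  split; [split; reflexivity|]; split; [lia|];
  split; [repeat split; apply Rabs_le; cj_bound|];
  split; [unfold cj; cbn [fst snd]; pose proof sqrt10_bounds; pose proof sqrt10_sqr; split; nra|].

(** The seeds follow the recursion in Z[sqrt 10] from z = (9, 3), u = (6, 2), v = (7, 2) through two
    steps A. Each of the three states gives a repetition of period z from the origin and one of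
    period v from u; a further step B yields the image of the first state under [scale]. *)
Lemma admissible_0 : admissible (9, 3)%Z (0, 0)%Z (13, 4)%Z.
Proof. admissible_base. exact no_hit_0. Qed.
Lemma admissible_1 : admissible (7, 2)%Z (6, 2)%Z (22, 7)%Z.
Proof. admissible_base. exact no_hit_1. Qed.
Lemma admissible_2 : admissible (16, 5)%Z (0, 0)%Z (22, 7)%Z.
Proof. admissible_base. exact no_hit_2. Qed.
Lemma admissible_3 : admissible (9, 3)%Z (13, 4)%Z (38, 12)%Z.
Proof. admissible_base. exact no_hit_3. Qed.
Lemma admissible_4 : admissible (25, 8)%Z (0, 0)%Z (38, 12)%Z.
Proof. admissible_base. exact no_hit_4. Qed.
Lemma admissible_5 : admissible (16, 5)%Z (22, 7)%Z (79, 25)%Z.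
Proof. admissible_base. exact no_hit_5. Qed.

Lemma approximated_cover b T : (2 <= b)%nat -> level_start (9, 3)%Z (0, 0)%Z <= T ->
  exists w w', w <= T < w' /\ w' <= (bound_const - 1) * w /\ approximated b w w'.
Proof.
  intros Hb HT. set (W0 := level_start (9, 3)%Z (0, 0)%Z) in *.
  pose proof sqrt10_bounds as Hs. pose proof sqrt10_sqr as Hs2.
  assert (HW0 : 0 < W0).
  { unfold W0, level_start, tr; cbn [fst snd]. apply Rdiv_lt_0_compat; lra. }
  destruct (min_ex (fun k => T < (3 + sqrt 10) ^ k * W0)) as (k & Hk & Hmin).
  { destruct (Pow_x_infinity (3 + sqrt 10)) with (b := T / W0 + 1) as [k Hk].
    - rewrite Rabs_pos_eq; lra.
    - exists k. specialize (Hk k (le_n k)).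
      rewrite Rabs_pos_eq in Hk by (apply pow_le; lra).
      apply (Rmult_lt_reg_r (/ W0)); [now apply Rinv_0_lt_compat|].
      rewrite Rmult_assoc, Rinv_r by lra. unfold Rdiv in Hk. lra. }
  destruct k as [|k]; [simpl in Hk; lra|].
  specialize (Hmin k (Nat.lt_succ_diag_r k)). apply Rnot_lt_le in Hmin.
  set (P := (3 + sqrt 10) ^ k) in *.
  assert (HP : 0 < P) by (apply pow_lt; lra).
  assert (G : forall pi l h w', admissible pi l h -> w' = level_end l h ->
    tr h - tr l <= (bound_const - 1) * (tr l + tr pi) -> P * level_start pi l <= T -> T < P * w' ->
    exists w w', w <= T < w' /\ w' <= (bound_const - 1) * w /\ approximated b w w').
  { intros pi l h w' Ha -> Hr H1 H2. exists (P * level_start pi l), (P * level_end l h).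
    split; [easy|]. split; [|now apply admissible_family].
    replace ((bound_const - 1) * (P * level_start pi l)) with (P * ((bound_const - 1) * level_start pi l)) by ring.
    apply Rmult_le_compat_l; [lra|]. unfold level_start, level_end, Rdiv. rewrite <- Rmult_assoc.
    apply Rmult_le_compat_r; [|easy]. left. apply Rinv_0_lt_compat. lra. }
  (* Each family ends where the next one starts, and the last ends where the first starts one level
     up. *)
  assert (E1 : level_start (7, 2)%Z (6, 2)%Z = level_end (0, 0)%Z (13, 4)%Z)
    by (unfold level_start, level_end, tr; cbn [fst snd]; field; lra).
  assert (E2 : level_start (16, 5)%Z (0, 0)%Z = level_end (6, 2)%Z (22, 7)%Z)
    by (unfold level_start, level_end, tr; cbn [fst snd]; field; lra).
  assert (E3 : level_start (9, 3)%Z (13, 4)%Z = level_end (0, 0)%Z (22, 7)%Z)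
    by (unfold level_start, level_end, tr; cbn [fst snd]; field; lra).
  assert (E4 : level_start (25, 8)%Z (0, 0)%Z = level_end (13, 4)%Z (38, 12)%Z)
    by (unfold level_start, level_end, tr; cbn [fst snd]; field; lra).
  assert (E5 : level_start (16, 5)%Z (22, 7)%Z = level_end (0, 0)%Z (38, 12)%Z)
    by (unfold level_start, level_end, tr; cbn [fst snd]; field; lra).
  assert (E6 : (3 + sqrt 10) * W0 = level_end (22, 7)%Z (79, 25)%Z).
  { unfold W0, level_start, level_end.
    change (tr (0, 0)%Z) with (0 + 0 * sqrt 10). unfold Rdiv. rewrite <- Rmult_assoc. f_equal.
    unfold tr; cbn [fst snd]. nra. }
  simpl in Hk. rewrite (Rmult_comm _ P) in Hk. rewrite Rmult_assoc, E6 in Hk.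
  (* As [bound_const - 1] is 2/3 + 4 sqrt 10 / 15, comparing the coefficients of 1 and sqrt 10
     reduces the ratio bound to integers. For [admissible_4] both comparisons are equalities. *)
  assert (R : forall A A' L L' H H' : Z,
    (3 * (H - L) <= 2 * (L + A) + 8 * (L' + A'))%Z -> (15 * (H' - L') <= 4 * (L + A) + 10 * (L' + A'))%Z ->
    tr (H, H') - tr (L, L') <= (bound_const - 1) * (tr (L, L') + tr (A, A'))).
  { intros A A' L L' H H' H1 H2. apply IZR_le in H1, H2.
    rewrite !plus_IZR, !mult_IZR, ?plus_IZR, !minus_IZR in H1, H2.
    unfold tr, bound_const; cbn [fst snd].
    replace ((5 / 3 + 4 * sqrt 10 / 15 - 1) * (IZR L + IZR L' * sqrt 10 + (IZR A + IZR A' * sqrt 10)))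
      with (2 / 3 * (IZR L + IZR A) + 4 / 15 * (sqrt 10 * sqrt 10) * (IZR L' + IZR A') +
        sqrt 10 * (2 / 3 * (IZR L' + IZR A') + 4 / 15 * (IZR L + IZR A))) by field.
    rewrite Hs2. nra. }
  destruct (Rlt_le_dec T (P * level_start (7, 2)%Z (6, 2)%Z)) as [H1|H1].
  { apply (G _ _ _ _ admissible_0 E1); [apply R; lia | easy | easy]. }
  destruct (Rlt_le_dec T (P * level_start (16, 5)%Z (0, 0)%Z)) as [H2|H2].
  { apply (G _ _ _ _ admissible_1 E2); [apply R; lia | easy | easy]. }
  destruct (Rlt_le_dec T (P * level_start (9, 3)%Z (13, 4)%Z)) as [H3|H3].
  { apply (G _ _ _ _ admissible_2 E3); [apply R; lia | easy | easy]. }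
  destruct (Rlt_le_dec T (P * level_start (25, 8)%Z (0, 0)%Z)) as [H4|H4].
  { apply (G _ _ _ _ admissible_3 E4); [apply R; lia | easy | easy]. }
  destruct (Rlt_le_dec T (P * level_start (16, 5)%Z (22, 7)%Z)) as [H5|H5].
  { apply (G _ _ _ _ admissible_4 E5); [apply R; lia | easy | easy]. }
  apply (G _ _ _ _ admissible_5 eq_refl); [apply R; lia | easy | easy].
Qed.

Lemma extremal_upper b : (2 <= b)%nat ->
  Rbar_le (irr_exponent (word_value b extremal_word)) bound_const.
Proof.
  intros Hb. replace bound_const with (1 + (bound_const - 1)) by ring.
  assert (HB : 2 <= INR b) by (apply le_INR in Hb; simpl in Hb; lra).
  assert (HC : 0 < INR b ^ 4) by (apply pow_lt; lra).
  apply irr_exponent_le with (INR b) (INR b ^ 4) (level_start (9, 3)%Z (0, 0)%Z); [lra | | easy |].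
  - unfold bound_const. pose proof sqrt10_bounds. lra.
  - intros T HT. destruct (approximated_cover b T Hb HT) as (w & w' & Hw & Hw' & p & q & Hq & Happ).
    exists p, q, w, w'. split; [easy|]. split; [easy|]. split; [lra | easy].
Qed.

(** The family of [admissible_4] has the critical ratio exactly and suffices alone; going through
    [lower_bound] would call for the complexity of the word. *)
Lemma extremal_lower b : (2 <= b)%nat ->
  Rbar_le bound_const (irr_exponent (word_value b extremal_word)).
Proof.
  intros Hb. replace bound_const with (1 + (bound_const - 1)) by ring.
  assert (HB : 2 <= INR b) by (apply le_INR in Hb; simpl in Hb; lra).
  pose proof sqrt10_bounds as Hs. pose proof sqrt10_sqr as Hs2.
  set (y := bound_const - 1).
  assert (Hy : 1 < y) by (unfold y, bound_const; lra).
  set (W := level_start (25, 8)%Z (0, 0)%Z).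
  assert (HW : 0 < W).
  { unfold W, level_start, tr; cbn [fst snd]. apply Rdiv_lt_0_compat; lra. }
  assert (EW : level_end (0, 0)%Z (38, 12)%Z = y * W).
  { unfold y, W, level_start, level_end, Rdiv. rewrite <- Rmult_assoc. f_equal.
    unfold tr, bound_const; cbn [fst snd].
    replace ((5 / 3 + 4 * sqrt 10 / 15 - 1) * (0 + 0 * sqrt 10 + (25 + 8 * sqrt 10)))
      with (50 / 3 + 12 * sqrt 10 + 32 / 15 * (sqrt 10 * sqrt 10)) by field.
    rewrite Hs2. field. }
  assert (HC : 0 < INR b ^ 4) by (apply pow_lt; lra).
  apply irr_exponent_ge with (INR b) (INR b ^ 4 * Rpower (INR b) (4 * y)); [lra | lra | |].
  { apply Rmult_lt_0_compat; [easy | apply exp_pos]. }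
  intros N.
  destruct (Pow_x_infinity (3 + sqrt 10)) with (b := N / W) as [k Hk]; [rewrite Rabs_pos_eq; lra|].
  specialize (Hk k (le_n k)). rewrite Rabs_pos_eq in Hk by (apply pow_le; lra).
  destruct (admissible_family b _ _ _ k Hb admissible_4) as (p & q & Hq & Hqw & Hlo & Hhi).
  fold W in Hqw. rewrite EW in Hlo, Hhi. set (P := (3 + sqrt 10) ^ k) in *.
  (* The b^4 in the bound on q moves into w, and b^(4 y) in the constant pays for the larger n. *)
  exists p, q, (4 + P * W), (y * (4 + P * W)).
  split; [easy|]. split; [|split; [|split; [lra | split]]].
  - rewrite Rpower_plus. replace 4 with (INR 4) by (simpl; ring).
    rewrite Rpower_pow by lra. exact Hqw.
  - assert (HN : N <= P * W).
    { apply (Rmult_le_reg_r (/ W)); [now apply Rinv_0_lt_compat|].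
      rewrite Rmult_assoc, Rinv_r by lra. unfold Rdiv in Hk. lra. }
    assert (0 < P * W) by (apply Rmult_lt_0_compat; [apply pow_lt; lra | easy]). nra.
  - apply Rlt_le_trans with (2 := Hlo). apply Rmult_lt_0_compat; [|apply exp_pos].
    now apply Rinv_0_lt_compat.
  - apply Rle_trans with (1 := Hhi). rewrite Rmult_assoc, <- Rpower_plus.
    right. do 2 f_equal. ring.
Qed.

Theorem theorem4p3 :
  (forall (b : nat) (s : word), (2 <= b)%nat -> word_over b s ->
     (sturmian s \/ quasi_sturmian s) ->
     Rbar_le (Finite bound_const) (irr_exponent (word_value b s)))
  /\
  (forall b : nat, (2 <= b)%nat ->
     irr_exponent (word_value b extremal_word) = Finite bound_const).
Proof.
  split.
  - exact lower_bound.
  - intros b Hb. apply Rbar_le_antisym; [now apply extremal_upper | now apply extremal_lower].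
Qed.
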